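(* Let $M$ be a homogeneous space of a connected Lie group $G$ with origin $o$, invariant measure $\mu$, and vector fields $V_1,\dots,V_d$, with semigroup $P_t$, carré du champ $\Gamma$ and heat kernel $p(t,\cdot)$ based at $o$, all as described in the context. Let $V_\varepsilon:M\to\mathbb R$, $0<\varepsilon\le1$, be a family of (smooth) potentials such that $$|V_\varepsilon+\log p(\varepsilon,\cdot)|\le D_\varepsilon\quad\text{on }M$$ for $0<\varepsilon\le1$ and constants $D_\varepsilon>0$. Assume furthermore that a Poincaré inequality holds for $\mathcal L^{\varepsilon}:=\mathcal L^{-\log p(\varepsilon,\cdot)}$, i.e. for $0<\varepsilon\le1$ there is a constant $a_\varepsilon>0$ such that $$a_\varepsilon\,P_\varepsilon(f^2)(o)\le P_\varepsilon(\Gamma(f,f))(o)$$ for all test functions $f\in C_0^\infty(M)$ with $P_\varepsilon f(o)=0$. Then one has $\exp(-V_\varepsilon)\in L^1(\mu)$, and the Poincaré inequality $$\int_M f^2(x)\exp(-V_\varepsilon(x))\,\mu(dx)\le C_\varepsilon\int_M\Gamma(f,f)(x)\exp(-V_\varepsilon(x))\,\mu(dx)$$ holds for all test functions $f\in C_0^\infty(M)$ with $\int_Mf(x)\exp(-V_\varepsilon(x))\,\mu(dx)=0$, with constant $C_\varepsilon=\frac{\exp(2D_\varepsilon)}{a_\varepsilon}>0$. In particular, this leads to a spectral gap of size at least $$\frac{1}{C_\varepsilon}=\frac{a_\varepsilon}{\exp(2D_\varepsilon)}$$ for $\mathcal L^{V_\varepsilon}$.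
   Context: Setting: $G$ is a finite-dimensional connected Lie group acting transitively on $M$ from the right, $(g,x)\mapsto\hat\pi(g,x)$; $\mu$ is a measure on $M$ invariant under this action; $o\in M$ is a fixed origin and $\pi:G\to M$, $\pi(g)=\hat\pi(g,o)$, is the associated surjection, so $o=\pi(e)$ with $e$ the identity of $G$. Left-invariant vector fields on $G$ generating (as a Lie algebra) the whole Lie algebra $\mathfrak g$ of $G$ are given; $V_1,\dots,V_d$ denote the fundamental vector fields on $M$ they induce, i.e. the field induced by $A\in\mathfrak g$ is $(Vf)(x)=\frac{d}{ds}\big|_{s=0}f(\hat\pi(\exp(sA),x))$. (The vector fields $V_1,\dots,V_d$ are not to be confused with the potentials $V_\varepsilon$.) $\mathcal L=\frac12\sum_{i=1}^dV_i^2$, which is symmetric on $L^2(\mu)$; $\Gamma(f,g)=\sum_{i=1}^d(V_if)(V_ig)$; $P_tf(x)=\mathbf E f(X^x_t)$ where $dX^x_t=\sum_{i=1}^dV_i(X^x_t)\circ dB^i_t$, $X_0^x=x$, with $B$ a $d$-dimensional Brownian motion; $p(t,\cdot)$ is the (smooth, positive) density of the law of $X^o_t$ with respect to $\mu$. $C_0^\infty(M)$ denotes the smooth compactly supported real functions. For a smooth $U:M\to\mathbb R$ with $\int e^{-U}d\mu<\infty$, $\mathcal L^U=\mathcal L-\frac12\Gamma(U,\cdot)$. By the paper's definition, $\mathcal L^U$ has a spectral gap at $0$ of size $a>0$ in $L^2(e^{-U}\mu)$ if and only if $\int_M\Gamma(f,f)e^{-U}d\mu\ge2a\int_Mf^2e^{-U}d\mu$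 for all $f\in C_0^\infty(M)$ with $\int_M fe^{-U}d\mu=0$.
   Formalization: The spectral gap is stated as 1/(2C_ε) instead of 1/C_ε: with the definition of gap size a as ∫Γ(f,f)e^{-U}dμ ≥ 2a∫f²e^{-U}dμ, the size 1/C_ε is false (Gaussian kernel on ℝ, V_ε = -log p, small D_ε); 1/(2C_ε) is what the Poincaré inequality gives. *)

(* Defs.v *)
From HB Require Import structures.
From mathcomp Require Import all_boot all_order all_algebra.
From mathcomp Require Import all_classical all_reals all_analysis.

Set Implicit Arguments.
Unset Strict Implicit.
Unset Printing Implicit Defensive.

Import Order.TTheory GRing.Theory Num.Theory numFieldNormedType.Exports.

Local Open Scope classical_set_scope.
Local Open Scope ring_scope.

Fixpoint Ck_on (R : realType) (n k : nat) (W : set 'rV[R]_n)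
    (f : 'rV[R]_n -> R) : Prop :=
  (forall u, W u -> {for u, continuous f}) /\
  (if k is k'.+1 then
     forall i : 'I_n,
       (forall u, W u -> derivable f u (delta_mx 0 i)) /\
       Ck_on k' W (fun u => 'D_(delta_mx 0 i) f u)
   else True).

(* Used only for open W. *)
Definition smooth_on (R : realType) (n : nat) (W : set 'rV[R]_n)
    (f : 'rV[R]_n -> R) : Prop := forall k, Ck_on k W f.

(* [cinv] is a total function; it is meaningful only on the image of [cdom]. *)
Record chart (R : realType) (T : Type) (n : nat) := Chart {
  cdom : set T;
  cmap : T -> 'rV[R]_n;
  cinv : 'rV[R]_n -> T }.

Section Manifold.
Context {R : realType}.

Definition cimage (T : Type) n (c : chart R T n) (D : set T) : set 'rV[R]_n :=
  cmap c @` (cdom c `&` D).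

Definition is_chart (T : topologicalType) n (c : chart R T n) : Prop :=
  [/\ open (cdom c), open (cimage c setT),
      (forall x, cdom c x -> cinv c (cmap c x) = x),
      (forall x, cdom c x -> {for x, continuous (cmap c)}) &
      (forall u, cimage c setT u -> {for u, continuous (cinv c)})].

Definition is_manifold (T : topologicalType) n (A : set (chart R T n)) : Prop :=
  [/\ hausdorff_space T, @second_countable T,
      (forall c, A c -> is_chart c),
      (forall x, exists2 c, A c & cdom c x) &
      (forall c c', A c -> A c' -> forall j : 'I_n,
         smooth_on (cimage c (cdom c')) (fun u => cmap c' (cinv c u) 0 j))].

Definition smooth_fun (T : topologicalType) n (A : set (chart R T n))
    (f : T -> R) : Prop :=
  forall c, A c -> smooth_on (cimage c setT) (fun u => f (cinv c u)).

Definition smooth_map (T T' : topologicalType) n n' (A : set (chart R T n))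
    (A' : set (chart R T' n')) (F : T -> T') : Prop :=
  continuous F /\
  (forall c c', A c -> A' c' -> forall j : 'I_n',
     smooth_on (cimage c (F @^-1` cdom c'))
               (fun u => cmap c' (F (cinv c u)) 0 j)).

Definition prod_chart (T T' : Type) n n' (c : chart R T n)
    (c' : chart R T' n') : chart R (T * T')%type (n + n') :=
  Chart (cdom c `*` cdom c')
        (fun z => row_mx (cmap c z.1) (cmap c' z.2))
        (fun u => (cinv c (lsubmx u), cinv c' (rsubmx u))).

Definition prod_atlas (T T' : Type) n n' (A : set (chart R T n))
    (A' : set (chart R T' n')) : set (chart R (T * T')%type (n + n')) :=
  [set e | exists c c', [/\ A c, A' c' & e = prod_chart c c']].

Definition test_function (T : topologicalType) n (A : set (chart R T n))
    (f : T -> R) : Prop :=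
  smooth_fun A f /\ compact (closure [set x | f x != 0]).

End Manifold.

#[short(type="ptopologicalGroupType")]
HB.structure Definition PTopologicalGroup :=
  {G of PointedTopological G & Group G}.

Section LieGroup.
Context {R : realType} {G : ptopologicalGroupType} {n : nat}.
Variable A : set (chart R G n).

Definition lie_group : Prop :=
  [/\ is_manifold A,
      smooth_map (prod_atlas A A) A (fun z : G * G => (z.1 * z.2)%g) &
      smooth_map A A (fun g : G => (g^-1)%g)].

(* Vector fields are derivations of the algebra of smooth functions; the values
   of an operator on non-smooth functions are irrelevant. *)
Definition vector_field (Z : (G -> R) -> G -> R) : Prop :=
  [/\ (forall f, smooth_fun A f -> smooth_fun A (Z f)),
      (forall (a : R) f h, smooth_fun A f -> smooth_fun A h ->
         forall x, Z (fun y => a * f y + h y) x = a * Z f x + Z h x) &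
      (forall f h, smooth_fun A f -> smooth_fun A h ->
         forall x, Z (fun y => f y * h y) x = f x * Z h x + h x * Z f x)].

Definition left_invariant (Z : (G -> R) -> G -> R) : Prop :=
  vector_field Z /\
  forall f, smooth_fun A f -> forall g x,
    Z (fun y => f (g * y)%g) x = Z f (g * x)%g.

Inductive lie_generated (d : nat) (Z : 'I_d -> (G -> R) -> G -> R) :
    ((G -> R) -> G -> R) -> Prop :=
| lie_gen i : lie_generated Z (Z i)
| lie_zero : lie_generated Z (fun _ _ => 0)
| lie_lin (a : R) X Y : lie_generated Z X -> lie_generated Z Y ->
    lie_generated Z (fun f x => a * X f x + Y f x)
| lie_bracket X Y : lie_generated Z X -> lie_generated Z Y ->
    lie_generated Z (fun f x => X (Y f) x - Y (X f) x).

Definition generates_lie_algebra (d : nat) (Z : 'I_d -> (G -> R) -> G -> R) :=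
  forall X, left_invariant X ->
  exists2 Y, lie_generated Z Y & forall f, smooth_fun A f -> X f = Y f.

(* [gamma s = exp (s Z)]: the integral curve of the left-invariant field [Z]
   issued from the identity. *)
Definition exponential_curve (Z : (G -> R) -> G -> R) (gamma : R -> G) : Prop :=
  gamma 0 = 1%g /\
  forall f, smooth_fun A f -> forall s : R,
    is_derive s 1 (fun r => f (gamma r)) (Z f (gamma s)).

(* The action is from the right: acting by [g * h] is acting by [g], then
   by [h]. *)
Definition smooth_right_action (M : topologicalType) m (AM : set (chart R M m))
    (act : G -> M -> M) : Prop :=
  [/\ (forall x, act 1%g x = x),
      (forall g h x, act (g * h)%g x = act h (act g x)) &
      smooth_map (prod_atlas A AM) AM (fun z : G * M => act z.1 z.2)].

Definition transitive_action (M : Type) (act : G -> M -> M) : Prop :=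
  forall x y, exists g, act g x = y.

Definition fundamental_field (M : Type) (act : G -> M -> M) (gamma : R -> G)
    (f : M -> R) (x : M) : R :=
  derive1 (fun s : R => f (act (gamma s) x)) 0.

End LieGroup.

Definition carre_du_champ (R : realType) (M : Type) (d : nat)
    (V : 'I_d -> (M -> R) -> M -> R) (f g : M -> R) (x : M) : R :=
  \sum_(i < d) V i f x * V i g x.

Notation borel M := (g_sigma_algebraType (@open M)).

Definition invariant_measure (R : realType) (G : Type) (M : ptopologicalType)
    (act : G -> M -> M) (mu : {measure set (borel M) -> \bar R}) : Prop :=
  forall g (S : set (borel M)), measurable S -> mu (act g @^-1` S) = mu S.

(* The factor 2 is due to [L^U = L - 1/2 Gamma(U, .)] with
   [L = 1/2 \sum_i V_i^2], for which
   [- \int f (L^U f) e^-U dmu = 1/2 \int Gamma(f, f) e^-U dmu].  In this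
   normalisation the Poincare inequality
   [\int f^2 e^-U dmu <= C * \int Gamma(f, f) e^-U dmu] is a gap of size
   [(2 C)^-1]. *)
Definition spectral_gap (R : realType) (M : ptopologicalType) (m d : nat)
    (AM : set (chart R M m)) (mu : {measure set (borel M) -> \bar R})
    (V : 'I_d -> (M -> R) -> M -> R) (U : M -> R) (a : R) : Prop :=
  [/\ smooth_fun AM U,
      mu.-integrable setT (fun x : borel M => (expR (- U x))%:E),
      0 < a &
      forall f : M -> R, test_function AM f ->
        (\int[mu]_x (f x * expR (- U x))%:E = 0)%E ->
        ((2 * a)%:E * \int[mu]_x (f x ^+ 2 * expR (- U x))%:E <=
         \int[mu]_x (carre_du_champ V f f x * expR (- U x))%:E)%E].

(* Processes are indexed by [R], only times [0 <= t] being relevant. *)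
Section Processes.
Context {R : realType} {dO : measure_display} {Omega : measurableType dO}.
Variables (P : probability Omega R) (F : R -> set (set Omega)).

Definition filtration : Prop :=
  [/\ (forall t, 0 <= t -> sigma_algebra setT (F t)),
      (forall t, 0 <= t -> F t `<=` measurable) &
      (forall s t, 0 <= s -> s <= t -> F s `<=` F t)].

Definition adapted (dS : measure_display) (S : measurableType dS)
    (X : R -> Omega -> S) : Prop :=
  forall t, 0 <= t -> forall E : set S, measurable E -> F t (X t @^-1` E).

Definition continuous_paths (S : topologicalType) (X : R -> Omega -> S) :=
  {ae P, forall w, {within `[0, +oo[, continuous (fun t : R => X t w)}}.

(* The last clause says that the increment of [B] over [[s, t]] is independent
   of [F s] and has law [N(0, (t - s) Id)]; the second parameter of
   [normal_prob] is the standard deviation. *)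
Definition brownian_motion (d : nat) (B : 'I_d -> R -> Omega -> R) : Prop :=
  [/\ (forall i, adapted (B i)),
      (forall i, {ae P, forall w, B i 0 w = 0}),
      (forall i, continuous_paths (B i)) &
      (forall s t, 0 <= s -> s < t -> forall E, F s E ->
       forall S : 'I_d -> set R, (forall i, measurable (S i)) ->
       P (E `&` [set w | forall i, S i (B i t w - B i s w)]) =
       (P E * (\prod_(i < d)
                 fine (normal_prob 0 (Num.sqrt (t - s)) (S i)))%:E)%E)].

Definition martingale (N : R -> Omega -> R) : Prop :=
  [/\ adapted N,
      (forall t, 0 <= t -> P.-integrable setT (EFin \o N t)) &
      (forall s t, 0 <= s -> s <= t -> forall E, F s E ->
       (\int[P]_(w in E) (N t w)%:E = \int[P]_(w in E) (N s w)%:E)%E)].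

Definition stopping_time (tau : Omega -> \bar R) : Prop :=
  (forall w, (0 <= tau w)%E) /\
  (forall t, 0 <= t -> F t [set w | (tau w <= t%:E)%E]).

Definition stopped (N : R -> Omega -> R) (tau : Omega -> \bar R) :
    R -> Omega -> R :=
  fun t w => N (fine (mine t%:E (tau w))) w.

Definition local_martingale (N : R -> Omega -> R) : Prop :=
  adapted N /\
  exists tau : nat -> Omega -> \bar R,
    [/\ (forall k, stopping_time (tau k)),
        {ae P, forall w, {homo (tau ^~ w) : k l / (k <= l)%N >-> (k <= l)%E}},
        {ae P, forall w, tau ^~ w @ \oo --> +oo%E} &
        (forall k, martingale (stopped N (tau k)))].

Definition continuous_semimartingale (Y : R -> Omega -> R) : Prop :=
  adapted Y /\
  exists N A : R -> Omega -> R,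
    [/\ (local_martingale N /\ continuous_paths N),
        (adapted A /\ continuous_paths A),
        {ae P, forall w, N 0 w = 0},
        {ae P, forall w, forall t, 0 <= t ->
           bounded_variation 0 t (fun r => A r w)} &
        {ae P, forall w, forall t, 0 <= t -> Y t w = N t w + A t w}].

Definition stratonovich_sum (Y W : R -> Omega -> R) (s : seq R) (w : Omega) : R :=
  \sum_(q <- zip (0 :: s) s)
    (Y q.1 w + Y q.2 w) / 2 * (W q.2 w - W q.1 w).

(* [J = \int_0^t Y o dW]: limit in probability of the trapezoidal sums along
   the partitions [0 :: s] of [[0, t]] whose mesh tends to [0]. *)
Definition stratonovich_integral (Y W : R -> Omega -> R) (t : R)
    (J : Omega -> R) : Prop :=
  measurable_fun setT J /\
  forall eta e : R, 0 < eta -> 0 < e ->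
  exists2 delta : R, 0 < delta &
    forall s : seq R, itv_partition 0 t s ->
      path (fun u v => v - u < delta) 0 s ->
      (P [set w | (eta <= `|stratonovich_sum Y W s w - J w|)%R] <= e%:E)%E.

(* [X] solves [dX = \sum_i V_i(X) o dB^i], [X_0 = x] on the manifold [M]: it is
   a continuous [M]-valued semimartingale such that
   [f(X_t) - f(x) = \sum_i \int_0^t V_i f(X_s) o dB^i_s] for all test functions
   [f]. *)
Definition sde_solution (M : ptopologicalType) (m d : nat)
    (AM : set (chart R M m)) (V : 'I_d -> (M -> R) -> M -> R)
    (B : 'I_d -> R -> Omega -> R) (x : M) (X : R -> Omega -> M) : Prop :=
  [/\ @adapted _ (borel M) X,
      continuous_paths X,
      {ae P, forall w, X 0 w = x},
      (forall f, test_function AM f ->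
         continuous_semimartingale (fun t w => f (X t w))) &
      (forall f, test_function AM f ->
       exists I : 'I_d -> R -> Omega -> R,
         (forall i t, 0 <= t ->
            stratonovich_integral (fun r w => V i f (X r w)) (B i) t (I i t)) /\
         (forall t, 0 <= t ->
            {ae P, forall w, f (X t w) - f x = \sum_(i < d) I i t w}))].

Definition semigroup (M : Type) (X : M -> R -> Omega -> M) (t : R)
    (f : M -> R) (x : M) : \bar R :=
  ('E_P[fun w => f (X x t w)])%E.

Definition heat_kernel (M : ptopologicalType) (m : nat)
    (AM : set (chart R M m)) (mu : {measure set (borel M) -> \bar R})
    (X : R -> Omega -> M) (p : R -> M -> R) : Prop :=
  forall t, 0 < t ->
  [/\ smooth_fun AM (p t), (forall x, 0 < p t x) &
      forall S : set (borel M), measurable S ->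
        P (X t @^-1` S) = (\int[mu]_(x in S) (p t x)%:E)%E].

End Processes.

(* Main.v *)
(* The heart of the matter is to apply the given Poincare inequality to [f - A],
   where [A] is the mean of [f] for the heat kernel, although [f - A] is not
   compactly supported. This requires test functions [chi_k] tending to [1]
   whose derivatives [V_i chi_k] are bounded and tend to [0]. On a homogeneous
   space they are obtained by averaging arbitrary cutoffs [psi] with values in
   [[0, 1]] over a small neighbourhood of the identity of [G]: since
   [chi x = avg_g psi (g x)] is differentiated along a fundamental field by
   moving [g], an integration by parts bounds [V_i chi] by a constant that does
   not depend on [psi]. The averages are taken over finite grids in a chart, so
   that they are test functions and the integration by parts is a summation by
   parts; the discretisation error is absorbed by refining the grid, depending
   on [psi]. The rest is the Holley-Stroock perturbation argument. *)
Require Import Defs.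
From HB Require Import structures.
From mathcomp Require Import all_boot all_order all_algebra.
From mathcomp Require Import all_classical all_reals all_analysis.
From mathcomp Require Import measurable_realfun ring lra.

Set Implicit Arguments.
Unset Strict Implicit.
Unset Printing Implicit Defensive.

Import Order.TTheory GRing.Theory Num.Theory numFieldNormedType.Exports.

Local Open Scope classical_set_scope.
Local Open Scope ring_scope.

(** * Functions of class [C^k] on Euclidean spaces *)

Section CkCalculus.
Context {R : realType}.
Implicit Types n k : nat.

(** The uniformity of the cutoffs comes from the group. As the action is from the right, flowing by
    [expZ i s] and then acting by [g] is acting by [expZ i s * g]. Hence differentiating a translate
    of [psi] along [V i] amounts to differentiating in [g] along a right-invariant field, whose
    chart components are bounded on a fixed cube whatever [psi] and [x] are. The mesh depends on
    [psi] through second derivatives of the orbit functions [u |-> psi (act (cinv c u) x)], which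
    are bounded uniformly in [x] because [psi] has compact support. Two features of the definitions
    shape the preparations. [Ck_on] speaks of partial derivatives only, so the chain rule must be
    won from Frechet differentiability. An exponential curve is known only through its compositions
    with globally smooth functions, so its chart coordinates must be recovered from bump functions.
    The factor [expR (2 * D e)] arises from exchanging the weights [p e] and [expR (- Veps e)]
    twice, once in each direction. *)

Lemma Ck_onS n k (W W' : set 'rV[R]_n) f :
  W' `<=` W -> Ck_on k W f -> Ck_on k W' f.
Proof.
move=> sWW'; elim: k f => [|k IH] f [cf df]; (split; first by move=> u /sWW' /cf).
  by [].
by move=> i; have [dif Dif] := df i; split; [move=> u /sWW' /dif|exact: IH].
Qed.

Lemma Ck_on_pred n k (W : set 'rV[R]_n) f : Ck_on k.+1 W f -> Ck_on k W f.
Proof.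
elim: k f => [|k IH] f [cf df]; split=> // i.
by have [dif Dif] := df i; split=> //; exact: IH.
Qed.

Lemma near_open n (W : set 'rV[R]_n) u : open W -> W u -> \forall v \near u, W v.
Proof. by move=> oW Wu; exact: open_nbhs_nbhs. Qed.

Lemma near_eq_continuous (T U : topologicalType) (f g : T -> U) x :
  (\near x, f x = g x) -> {for x, continuous f} -> {for x, continuous g}.
Proof.
move=> fg cf; rewrite /prop_for /continuous_at -(nbhs_singleton fg).
exact: cvg_trans (near_eq_cvg fg) cf.
Qed.

Lemma Ck_on_eq n k (W : set 'rV[R]_n) f g : open W ->
  (forall u, W u -> f u = g u) -> Ck_on k W f -> Ck_on k W g.
Proof.
move=> oW; elim: k f g => [|k IH] f g fg [cf df].
  split=> // u Wu; apply: near_eq_continuous (cf u Wu).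
  by apply: filterS (near_open oW Wu) => v /fg.
split=> [u Wu|i].
  apply: near_eq_continuous (cf u Wu).
  by apply: filterS (near_open oW Wu) => v /fg.
have [dif Dif] := df i; split=> [u Wu|].
  apply: near_eq_derivable (dif u Wu).
  by apply: filterS (near_open oW Wu) => v /fg.
apply: IH Dif => u Wu; apply: near_eq_derive.
by apply: filterS (near_open oW Wu) => v /fg.
Qed.

(** All clauses of [Ck_on] are pointwise, with continuity and derivatives taken in the whole space,
    so pieces glue along any sets [W'], open or not. *)
Lemma Ck_on_local n k (W : set 'rV[R]_n) f :
  (forall u, W u -> exists2 W', W' u & Ck_on k W' f) -> Ck_on k W f.
Proof.
elim: k f => [|k IH] f lf.
  by split=> // u /lf[W' W'u [+ _]]; exact.
split=> [u /lf[W' W'u [+ _]]|i]; first exact.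
split=> [u /lf[W' W'u [_ /(_ i)[+ _]]]|]; first exact.
by apply: IH => u /lf[W' W'u [_ /(_ i)[_ ?]]]; exists W'.
Qed.

Lemma Ck_on_cst n k (W : set 'rV[R]_n) (a : R) : Ck_on k W (fun=> a).
Proof.
elim: k a => [|k IH] a; split=> //; try by move=> u _; exact: cst_continuous.
move=> i; split=> [u _|]; first exact: (@derivable_cst _ _ _ a).
have -> : 'D_(delta_mx 0 i) (fun=> a) = (fun=> 0) :> ('rV[R]_n -> R).
  by apply/funext => u; exact: (@derive_cst _ _ _ a).
exact: IH.
Qed.

Lemma Ck_onD n k (W : set 'rV[R]_n) f g : open W ->
  Ck_on k W f -> Ck_on k W g -> Ck_on k W (fun u => f u + g u).
Proof.
move=> oW; elim: k f g => [|k IH] f g [cf df] [cg dg].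
  by split=> // u Wu; apply: continuousD; [exact: cf|exact: cg].
split=> [u Wu|i]; first by apply: continuousD; [exact: cf|exact: cg].
have [dif Dif] := df i; have [dig Dig] := dg i; split=> [u Wu|].
  by apply: derivableD; [exact: dif|exact: dig].
apply: (Ck_on_eq oW) (IH _ _ Dif Dig) => u Wu.
by rewrite deriveD //; [exact: dif|exact: dig].
Qed.

Lemma Ck_onM n k (W : set 'rV[R]_n) f g : open W ->
  Ck_on k W f -> Ck_on k W g -> Ck_on k W (fun u => f u * g u).
Proof.
move=> oW; elim: k f g => [|k IH] f g Cf Cg; have [cf df] := Cf;
  have [cg dg] := Cg.
  by split=> // u Wu; apply: continuousM; [exact: cf|exact: cg].
split=> [u Wu|i]; first by apply: continuousM; [exact: cf|exact: cg].
have [dif Dif] := df i; have [dig Dig] := dg i; split=> [u Wu|].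
  by apply: derivableM; [exact: dif|exact: dig].
have := Ck_onD oW (IH _ _ (Ck_on_pred Cf) Dig) (IH _ _ (Ck_on_pred Cg) Dif).
apply: (Ck_on_eq oW) => u Wu.
by rewrite deriveM //; [exact: dif|exact: dig].
Qed.

Lemma Ck_onV n k (W : set 'rV[R]_n) f : open W ->
  (forall u, W u -> f u != 0) -> Ck_on k W f -> Ck_on k W (fun u => (f u)^-1).
Proof.
move=> oW f0; elim: k => [|k IH] Cf; have [cf df] := Cf.
  by split=> // u Wu; apply: continuousV; [exact: f0|exact: cf].
split=> [u Wu|i]; first by apply: continuousV; [exact: f0|exact: cf].
have [dif Dif] := df i; split=> [u Wu|].
  by apply: derivableV; [exact: f0|exact: dif].
have CV := IH (Ck_on_pred Cf).
have := Ck_onM oW (Ck_on_cst k W (-1)) (Ck_onM oW (Ck_onM oW CV CV) Dif).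
apply: (Ck_on_eq oW) => u Wu.
rewrite deriveV; [|exact: f0|exact: dif].
by rewrite mulN1r scaleNr expr2 invfM.
Qed.

Lemma Ck_on_sum n k (W : set 'rV[R]_n) (I : Type) (r : seq I) (f : I -> 'rV[R]_n -> R) :
  open W -> (forall i, Ck_on k W (f i)) ->
  Ck_on k W (fun u => \sum_(i <- r) f i u).
Proof.
move=> oW Cf; elim: r => [|i r IH].
  by under eq_fun do rewrite big_nil; exact: Ck_on_cst.
by under eq_fun do rewrite big_cons; exact: Ck_onD.
Qed.

Lemma is_derive_coord n (j : 'I_n) (u v : 'rV[R]_n) :
  is_derive u v (fun w => w 0 j) (v 0 j).
Proof.
have dM : derivable (id : 'rV[R]_n -> 'rV[R]_n) u v by exact: derivable_id.
apply: DeriveDef; first by move/derivable_mxP : dM => /(_ 0 j).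
have := derive_mx dM; rewrite derive_id => /matrixP/(_ 0 j).
by rewrite mxE.
Qed.

Lemma Ck_on_coord n k (W : set 'rV[R]_n) (j : 'I_n) : Ck_on k W (fun u => u 0 j).
Proof.
case: k => [|k]; (split; first by move=> u _; exact: coord_continuous) => // i.
split=> [u _|]; first by have [] := is_derive_coord j u (delta_mx 0 i).
have -> : 'D_(delta_mx 0 i) (fun u : 'rV[R]_n => u 0 j) =
    (fun=> (delta_mx 0 i : 'rV[R]_n) 0 j).
  by apply/funext => u; have [] := is_derive_coord j u (delta_mx 0 i).
exact: Ck_on_cst.
Qed.

End CkCalculus.

(** * Mean value theorem, Frechet differentiability and the chain rule *)

Section DifferentialCalculus.
Context {R : realType}.

Lemma is_derive_line n (f : 'rV[R]_n -> R) (w v : 'rV[R]_n) (t : R) :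
  derivable f (w + t *: v) v ->
  is_derive t 1 (fun r => f (w + r *: v)) ('D_v f (w + t *: v)).
Proof.
move=> df.
have E : (fun h : R => h^-1 *: (((fun r => f (w + r *: v)) \o shift t) (h *: 1) -
      f (w + t *: v))) =
    (fun h : R => h^-1 *: ((f \o shift (w + t *: v)) (h *: v) - f (w + t *: v))).
  apply/funext => h /=; congr (_ *: (f _ - _)).
  by rewrite [h *: 1]mulr1 scalerDl addrCA addrC.
by apply: DeriveDef; rewrite /derivable /derive E.
Qed.

(** Both signs of [s] occur, as the coordinates of an increment are arbitrary in
    [C1_differentiable]; for [s < 0] the one-variable theorem is applied on [[s, 0]]. *)
Lemma MVT_line n (W : set 'rV[R]_n) (f : 'rV[R]_n -> R) (w v : 'rV[R]_n) (s : R) :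
  (forall c : R, `|c| <= `|s| -> W (w + c *: v)) ->
  (forall u, W u -> derivable f u v) ->
  exists2 c : R, `|c| <= `|s| & f (w + s *: v) - f w = 'D_v f (w + c *: v) * s.
Proof.
move=> Ws df.
pose phi r := f (w + r *: v).
have dphi (c : R) : `|c| <= `|s| -> is_derive c (1 : R) phi ('D_v f (w + c *: v)).
  by move=> cs; apply: is_derive_line; exact/df/Ws.
have cphi (c : R) : `|c| <= `|s| -> {for c, continuous phi}.
  move=> cs; apply: differentiable_continuous.
  by apply/derivable1_diffP; have [] := dphi _ cs.
have [s0|s0] := leP 0 s.
- have [||c cs] := @MVT_segment _ phi (fun c => 'D_v f (w + c *: v)) _ _ s0.
  + by move=> c; rewrite in_itv /= => /andP[c0 cs]; apply: dphi;
      rewrite !ger0_norm // ltW.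
  + apply: continuous_in_subspaceT => c; rewrite inE /= in_itv /= => /andP[c0 cs].
    by apply: cphi; rewrite !ger0_norm.
  rewrite /phi scale0r addr0 subr0 => ->; exists c => //.
  by move: cs; rewrite in_itv /= => /andP[c0 cs]; rewrite !ger0_norm.
- have [||c cs] := @MVT_segment _ phi (fun c => 'D_v f (w + c *: v)) _ _ (ltW s0).
  + by move=> c; rewrite in_itv /= => /andP[c0 cs]; apply: dphi;
      rewrite !ltr0_norm // lerN2 ltW.
  + apply: continuous_in_subspaceT => c; rewrite inE /= in_itv /= => /andP[c0 cs].
    by apply: cphi; rewrite (ltr0_norm s0) ler0_norm // lerN2.
  rewrite /phi scale0r addr0 sub0r mulrN => /eqP.
  rewrite eq_sym eqr_oppLR opprB => /eqP <-; exists c => //.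
  by move: cs; rewrite in_itv /= => /andP[c0 cs];
    rewrite (ltr0_norm s0) ler0_norm // lerN2.
Qed.

Lemma rV_norm_le n (v : 'rV[R]_n) (e : R) : 0 <= e ->
  (`|v| <= e) <-> (forall j, `|v 0 j| <= e).
Proof.
move=> e0; rewrite /Num.Def.normr /= mx_normrE; split=> [+ j|ve].
  by apply: le_trans; exact: (le_bigmax _ (fun ij : 'I_1 * 'I_n => `|v ij.1 ij.2|) (0, j)).
by apply: bigmax_le => // -[i j] _; rewrite ord1; exact: ve.
Qed.

(** The increment [v] is covered one coordinate at a time. By the mean value theorem each leg
    contributes a partial derivative at a nearby point, which continuity compares with its value at
    [u]. *)
Lemma C1_differentiable n (W : set 'rV[R]_n) f u : open W -> W u ->
  Ck_on 1 W f -> differentiable f u.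
Proof.
move=> oW Wu [cf df].
have dfW j w : W w -> derivable f w (delta_mx 0 j) by move=> Ww; have [] := df j; move=> /(_ w Ww).
pose L (v : 'rV[R]_n) : R := \sum_j v 0 j * 'D_(delta_mx 0 j) f u.
have Llin : linear L.
  move=> a v w; rewrite /L scaler_sumr -big_split /=; apply: eq_bigr => j _.
  by rewrite !mxE mulrDl -scalerAl.
pose LM := GRing.isLinear.Build R 'rV[R]_n R *:%R L Llin.
pose LL : {linear 'rV[R]_n -> R} := HB.pack L LM.
have Lc : continuous LL.
  have [+ _] : Ck_on 0 setT L.
    apply: Ck_on_sum openT _ => j.
    exact: Ck_onM openT (Ck_on_coord _ _ _) (Ck_on_cst _ _ _).
  by move=> cL v; exact: cL.
suff H : f \o shift u = cst (f u) + LL +o_ (0 : 'rV[R]_n) id.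
  by apply/diff_locallyP; rewrite (diff_unique Lc H).
apply/eqaddoP => _/posnumP[e].
(* Each of the [n] legs may cost [e'] times the norm of [v]; dividing by [n.+1] rather than [n]
   covers [n = 0]. *)
pose e' := e%:num / n.+1%:R.
have e'0 : 0 < e' by rewrite divr_gt0.
have : \forall w \near u, W w /\
    forall j, `|'D_(delta_mx 0 j) f u - 'D_(delta_mx 0 j) f w| <= e'.
  near=> w; split; first by near: w; exact: near_open.
  near: w; apply: filter_forall => j.
  have [_ [/(_ u Wu) cD _]] := df j.
  by move/cvgrPdist_le : cD => /(_ e' e'0).
move=> /nbhs_ballP[d /= d0 dW].
near=> v.
have vd : `|v| < d.
  by near: v; apply/nbhs_ballP; exists d => //= v; rewrite -ball_normE /= sub0r normrN.
(* The corners of the path: [T k] keeps the first [k] coordinates of [v]. In the sup norm no point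
   of a leg is farther from [u] than the norm of [v]. *)
pose T (k : nat) := \row_(j < n) (if (j < k)%N then v 0 j else 0).
have inW (k : nat) (i : 'I_n) c : (k <= i)%N -> `|c| <= `|v| ->
    ball u d (u + T k + c *: delta_mx 0 i).
  move=> ki cv; rewrite -ball_normE /= -addrA opprD addNKr normrN.
  apply: le_lt_trans vd; apply/rV_norm_le => // j; rewrite !mxE /=.
  have [jk|jk] := ltnP j k.
    have /negbTE -> : j != i by rewrite -val_eqE /= ltn_eqF // (leq_trans jk).
    by rewrite mulr0 addr0; have /rV_norm_le := lexx `|v|; apply.
  rewrite add0r; by case: (j == i); rewrite ?mulr1 // mulr0 normr0.
have T0 : T 0%N = 0 by apply/rowP => j; rewrite !mxE.
have Tn : T n = v by apply/rowP => j; rewrite !mxE ltn_ord.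
have TS (k : 'I_n) : T k.+1 = T k + v 0 k *: delta_mx 0 k.
  apply/rowP => j; rewrite !mxE /= ltnS leq_eqVlt.
  have [->|jk] := eqVneq j k; first by rewrite eqxx ltnn mulr1 add0r.
  by rewrite val_eqE (negbTE jk) /= mulr0 addr0.
have -> : (f \o shift u - (cst (f u) + LL)) v =
    \sum_(k < n) (f (u + T k.+1) - f (u + T k) - v 0 k * 'D_(delta_mx 0 k) f u).
  rewrite sumrB -(big_mkord xpredT (fun k => f (u + T k.+1) - f (u + T k))).
  rewrite (telescope_sumr (fun k => f (u + T k))) // T0 Tn addr0.
  transitivity (f (v + u) - (f u + L v)) => //.
  by rewrite opprD addrA [v + u]addrC.
apply: le_trans (ler_norm_sum _ _ _) _.
have -> : e%:num * `|id v| = \sum_(k < n) e' * `|v| + e' * `|v|.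
  by rewrite sumr_const card_ord -mulrSr -mulr_natr mulrAC divfK ?pnatr_eq0.
rewrite -[leLHS]addr0 lerD ?mulr_ge0 ?(ltW e'0) //.
apply: ler_sum => k _.
have vk : `|v 0 k| <= `|v| by have /rV_norm_le := lexx `|v|; apply.
have [|w /dW[]//|c cv] := @MVT_line _ (ball u d) f (u + T k) (delta_mx 0 k) (v 0 k).
- by move=> c cv; apply: inW => //; exact: le_trans vk.
- by move=> *; exact: dfW.
rewrite TS addrA => ->; rewrite mulrC -mulrBr normrM mulrC.
apply: ler_pM => //; rewrite distrC.
have /dW[_] := inW k k c (leqnn _) (le_trans cv vk); exact.
Unshelve. all: by end_near. Qed.

(** Only directional derivatives of the coordinates of [Phi] are given. Restricted to the line
    through [a] in direction [v], [Phi] becomes a function of one real variable, for which derivable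
    means differentiable, so the chain rule for differentials applies. *)
Lemma is_derive_comp_rV n (V : normedModType R) (W : set 'rV[R]_n) f
    (Phi : V -> 'rV[R]_n) a v (dPhi : 'rV[R]_n) :
  open W -> W (Phi a) -> Ck_on 1 W f ->
  (forall j, is_derive a v (fun x => Phi x 0 j) (dPhi 0 j)) ->
  is_derive a v (fun x => f (Phi x))
    (\sum_j 'D_(delta_mx 0 j) f (Phi a) * dPhi 0 j).
Proof.
move=> oW Wa Cf dP.
have df := C1_differentiable oW Wa Cf.
have dPhia : derivable Phi a v.
  by apply/derivable_mxP => i j; rewrite ord1; have [] := dP j.
have DPhi : 'D_v Phi a = dPhi.
  rewrite derive_mx //; apply/rowP => j; rewrite mxE.
  by have [] := dP j.
pose P h := Phi (h *: v + a).
have P0 : P 0 = Phi a by rewrite /P scale0r add0r.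
have dP0 : differentiable P (0 : R).
  by apply/derivable1_diffP; move/derivable1P: dPhia.
have dfP0 : differentiable f (P 0) by rewrite P0.
have dfP : differentiable (f \o P) (0 : R) by exact: differentiable_comp.
have derE (U : normedModType R) (g : V -> U) :
    'D_v g a = 'D_1 (fun h : R => g (h *: v + a)) 0.
  rewrite /derive; suff -> : (fun h : R => h^-1 *: ((g \o shift a) (h *: v) - g a)) =
      (fun h : R => h^-1 *: (((fun r : R => g (r *: v + a)) \o shift 0) (h *: 1) -
        g (0 *: v + a))) by [].
  by apply/funext => h /=; rewrite addr0 scale0r add0r [h *: 1]mulr1.
apply: DeriveDef; first exact: ((derivable1P _ _ _).2 ((derivable1_diffP _ _).2 dfP)).
rewrite derE -[LHS]/('D_1 (f \o P) 0) deriveE // diff_comp //= P0.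
rewrite -(deriveE _ dP0) -derE DPhi [dPhi in LHS]row_sum_delta linear_sum /=.
by apply: eq_bigr => j _; rewrite linearZ /= -deriveE // mulrC.
Qed.

End DifferentialCalculus.

(** * Smooth bump functions *)

Section SmoothBump.
Context {R : realType}.

Lemma Ck_on_le n k k' (W : set 'rV[R]_n) f : (k <= k')%N -> Ck_on k' W f -> Ck_on k W f.
Proof.
move=> /subnK <-; elim: (k' - k)%N => [//|i IH].
by rewrite addSn => /Ck_on_pred.
Qed.

Lemma rV_continuous (T : topologicalType) n (Phi : T -> 'rV[R]_n) x :
  (forall j, {for x, continuous (fun y => Phi y 0 j)}) -> {for x, continuous Phi}.
Proof.
move=> cPhi; apply/cvgrPdist_le => /= e e0; near=> y.
apply/rV_norm_le; first exact: ltW.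
move=> j; rewrite !mxE; move: j; near: y; apply: filter_forall => j.
by have /cvgrPdist_le/(_ e e0) := cPhi j.
Unshelve. all: by end_near. Qed.

Lemma Ck_on_comp n m k (W : set 'rV[R]_n) (W' : set 'rV[R]_m) f Phi :
  open W -> open W' -> (forall u, W u -> W' (Phi u)) ->
  (forall j, Ck_on k W (fun u => Phi u 0 j)) -> Ck_on k W' f ->
  Ck_on k W (fun u => f (Phi u)).
Proof.
move=> oW oW' WW' CPhi; elim: k f CPhi => [|k IH] f CPhi Cf.
  split=> // u Wu; apply: continuous_comp.
    by apply: rV_continuous => j; have [+ _] := CPhi j; exact.
  by have [+ _] := Cf; apply; exact: WW'.
have dfP i u : W u -> is_derive u (delta_mx 0 i) (fun u => f (Phi u))
    (\sum_j 'D_(delta_mx 0 j) f (Phi u) * 'D_(delta_mx 0 i) (fun u => Phi u 0 j) u).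
  move=> Wu; have C1f := Ck_on_le (ltn0Sn k) Cf.
  have := @is_derive_comp_rV _ _ _ W' f Phi u (delta_mx 0 i)
    (\row_j 'D_(delta_mx 0 i) (fun u => Phi u 0 j) u) oW' (WW' _ Wu) C1f.
  under eq_bigr do rewrite mxE; apply => j; rewrite mxE; apply: derivableP.
  by have [_ /(_ i)[+ _]] := CPhi j; exact.
split=> [u Wu|i].
  apply: continuous_comp.
    by apply: rV_continuous => j; have [+ _] := CPhi j; exact.
  by have [+ _] := Cf; apply; exact: WW'.
split=> [u Wu|]; first by have [] := dfP i u Wu.
have : Ck_on k W (fun u => \sum_j 'D_(delta_mx 0 j) f (Phi u) *
    'D_(delta_mx 0 i) (fun u => Phi u 0 j) u).
  apply: Ck_on_sum => // j; apply: Ck_onM => //.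
    apply: (IH ('D_(delta_mx 0 j) f)) => [j'|]; first exact: Ck_on_pred.
    by have [_ /(_ j)[]] := Cf.
  by have [_ /(_ i)[]] := CPhi j.
by apply: Ck_on_eq => // u Wu; have [_ ->] := dfP i u Wu.
Qed.

Lemma Ck_on_row_mx n m p k (W : set 'rV[R]_n) (f : 'rV[R]_n -> 'rV[R]_m)
    (g : 'rV[R]_n -> 'rV[R]_p) :
  (forall j, Ck_on k W (fun u => f u 0 j)) -> (forall j, Ck_on k W (fun u => g u 0 j)) ->
  forall j, Ck_on k W (fun u => row_mx (f u) (g u) 0 j).
Proof.
move=> Cf Cg j; case: (split_ordP j) => i ->.
  by under eq_fun do rewrite row_mxEl.
by under eq_fun do rewrite row_mxEr.
Qed.

Lemma Ck_on_prod n k (W : set 'rV[R]_n) (I : Type) (r : seq I) (f : I -> 'rV[R]_n -> R) :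
  open W -> (forall i, Ck_on k W (f i)) ->
  Ck_on k W (fun u => \prod_(i <- r) f i u).
Proof.
move=> oW Cf; elim: r => [|i r IH].
  by under eq_fun do rewrite big_nil; exact: Ck_on_cst.
by under eq_fun do rewrite big_cons; exact: Ck_onM.
Qed.

(** [flat 0] is the classical flat function [exp (-1/x)]. The powers of [1/x] make the family stable
    under differentiation up to linear combinations, so smoothness follows by induction on the
    order. *)
Definition flat k (x : R) : R := if 0 < x then x^-1 ^+ k * expR (- x^-1) else 0.

Lemma flat_ge0 k x : 0 <= flat k x.
Proof.
by rewrite /flat; case: ifPn => // x0; rewrite mulr_ge0 ?expR_ge0 // exprn_ge0 // invr_ge0 ltW.
Qed.

(** At [y = 1/x], [expR y] dominates [y ^+ k.+1 / k.+1!]; using one power more than [flat k]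
    contains leaves a factor [x]. *)
Lemma flat_le k x : flat k x <= k.+1`!%:R * `|x|.
Proof.
rewrite /flat; case: ifPn => [x0|_]; last by rewrite mulr_ge0.
have y0 : 0 < x^-1 by rewrite invr_gt0.
have := @expR_ge1Dxn R x^-1 k (ltW y0).
move=> /(le_trans _) H.
have {}H : x^-1 ^+ k.+1 <= k.+1`!%:R * expR x^-1.
  rewrite -ler_pdivrMl ?ltr0n ?fact_gt0 // mulrC; apply: H.
  by rewrite lerDr.
rewrite gtr0_norm // expRN ler_pdivrMr ?expR_gt0 //.
by rewrite mulrAC -ler_pdivrMr // -exprSr.
Qed.

Lemma is_derive_flat k (x : R) :
  is_derive x (1 : R) (flat k) (flat k.+2 x - k%:R * flat k.+1 x).
Proof.
have [x0|x0|->] := ltgtP x 0.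
- have -> : flat k.+2 x - k%:R * flat k.+1 x = 0.
    by rewrite /flat ltNge ltW //= mulr0 subr0.
  apply: (@near_eq_is_derive _ _ _ (cst 0) _ _ _ _ _ (is_derive_cst _ _ _)).
  near=> y; rewrite /flat ltNge ltW //; near: y; exact: lt_nbhsl.
- apply: (@near_eq_is_derive _ _ _ (fun y : R => y^-1 ^+ k * expR (- y^-1))).
    near=> y; rewrite /flat ifT //; near: y; exact: lt_nbhsr.
  have dV : is_derive x (1 : R) (fun y : R => y^-1) (- x^-1 ^+ 2).
    have x0' : x != 0 by rewrite gt_eqF.
    apply: is_derive_eq (is_deriveV x0' (is_derive_id x (1 : R))) _.
    by rewrite exprVn [LHS]mulr1.
  have dE : is_derive x (1 : R) (fun y : R => expR (- y^-1)) (expR (- x^-1) * x^-1 ^+ 2).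
    have := is_deriveN dV; rewrite opprK => dN.
    exact: (is_derive1_comp (g := - (fun y : R => y^-1)) (is_derive_expR _) dN).
  have -> : (fun y : R => y^-1 ^+ k * expR (- y^-1)) =
      (fun y : R => y^-1) ^+ k * (fun y : R => expR (- y^-1)).
    by apply/funext => y; rewrite exprfctE.
  apply: is_derive_eq (is_deriveM (is_deriveX k dV) dE) _.
  rewrite /flat x0 /GRing.scale /= exprfctE; case: k => [|k].
    by rewrite !mul0r !mulr0 addr0 subr0 !expr0 mul1r; ring.
  by rewrite /= !exprS; ring.
- have f0 j : flat j 0 = 0 by rewrite /flat ltxx.
  rewrite !f0 mulr0 subr0.
  (* The difference quotient of [flat k] at 0 is [flat k.+1] itself, so [flat_le] sends it to 0. *)
  have E h : h != 0 -> h^-1 *: (flat k (h *: 1 + 0) - flat k 0) = flat k.+1 h.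
    move=> h0; rewrite f0 subr0 addr0 [h *: 1]mulr1 /flat.
    by case: ifPn => _; rewrite ?scaler0 // [LHS]mulrA exprS.
  have H : (fun h => h^-1 *: ((flat k \o shift 0) (h *: 1) - flat k 0)) @ (0 : R)^' --> (0 : R).
    apply/cvgrPdist_le => e e0; near=> h.
    have h0 : h != 0 by near: h; exact: nbhs_dnbhs_neq.
    rewrite /= E // sub0r normrN ger0_norm ?flat_ge0 //.
    apply: le_trans (flat_le _ _) _.
    rewrite -ler_pdivlMl ?ltr0n ?fact_gt0 //.
    near: h; apply: dnbhs0_le; rewrite mulr_gt0 // invr_gt0 ltr0n fact_gt0 //.
  by apply: DeriveDef; [apply/cvg_ex; exists 0|exact: cvg_lim].
Unshelve. all: by end_near. Qed.

(** A function of one real variable is viewed on row vectors of length 1, so that [Ck_on_comp] can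
    compose it in [Ck_on_flat]. *)
Lemma Ck_on_flat1 k j : Ck_on k setT (fun w : 'rV[R]_1 => flat j (w 0 0)).
Proof.
have dflat i (w : 'rV[R]_1) l : is_derive w (delta_mx 0 i) (fun w : 'rV[R]_1 => flat l (w 0 0))
    (flat l.+2 (w 0 0) - l%:R * flat l.+1 (w 0 0)).
  have [dl Dl] := is_derive_flat l (w 0 0).
  have E : (fun h : R => h^-1 *: (((fun w : 'rV[R]_1 => flat l (w 0 0)) \o shift w)
        (h *: delta_mx 0 i) - flat l (w 0 0))) =
      (fun h : R => h^-1 *: ((flat l \o shift (w 0 0)) (h *: 1) - flat l (w 0 0))).
    by apply/funext => h /=; rewrite !mxE !ord1 /=.
  by apply: DeriveDef; rewrite /derivable /derive E.
elim: k j => [|k IH] j; (split=> [u _|//]).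
1,2: apply: (@continuous_comp _ _ _ (fun w : 'rV[R]_1 => w 0 0)); [exact: coord_continuous|];
  apply: differentiable_continuous; apply/derivable1_diffP;
  by have [] := is_derive_flat j (u 0 0).
move=> i; split=> [u _|]; first by have [] := dflat i u j.
have : Ck_on k setT (fun w : 'rV[R]_1 => flat j.+2 (w 0 0) + - j%:R * flat j.+1 (w 0 0)).
  apply: Ck_onD (IH _) _; first exact: openT.
  exact: Ck_onM openT (Ck_on_cst _ _ _) (IH _).
apply: Ck_on_eq openT _ => u _; have [_ ->] := dflat i u j.
by rewrite mulNr.
Qed.

Lemma Ck_on_flat n k j (W : set 'rV[R]_n) F : open W ->
  Ck_on k W F -> Ck_on k W (fun u => flat j (F u)).
Proof.
move=> oW CF.
have : Ck_on k W (fun u => flat j ((const_mx (F u) : 'rV[R]_1) 0 0)).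
  apply: (@Ck_on_comp n 1 k W setT (fun w => flat j (w 0 0))) (Ck_on_flat1 k j) => //.
    exact: openT.
  by move=> i; apply: Ck_on_eq CF => // u _; rewrite mxE.
by apply: Ck_on_eq => // u _; rewrite mxE.
Qed.

Definition smooth_step (x : R) : R := flat 0 x / (flat 0 x + flat 0 (1 - x)).

Lemma flat0_gt0 (x : R) : 0 < x -> 0 < flat 0 x.
Proof. by move=> x0; rewrite /flat x0 mul1r expR_gt0. Qed.

Lemma smooth_step_den_gt0 x : 0 < flat 0 x + flat 0 (1 - x).
Proof.
have [x0|x0] := ltP 0 x; first by rewrite ltr_pwDl ?flat0_gt0 ?flat_ge0.
by rewrite ltr_wpDl ?flat_ge0 // flat0_gt0 // subr_gt0 (le_lt_trans x0).
Qed.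

Lemma smooth_step_ge0 x : 0 <= smooth_step x.
Proof. by rewrite divr_ge0 ?flat_ge0 // ltW // smooth_step_den_gt0. Qed.

Lemma smooth_step_le1 x : smooth_step x <= 1.
Proof. by rewrite ler_pdivrMr ?smooth_step_den_gt0 // mul1r lerDl flat_ge0. Qed.

Lemma smooth_step_eq0 x : x <= 0 -> smooth_step x = 0.
Proof. by move=> x0; rewrite /smooth_step {1}/flat ltNge x0 mul0r. Qed.

Lemma smooth_step_eq1 x : 1 <= x -> smooth_step x = 1.
Proof.
move=> x1; have f0 : flat 0 (1 - x) = 0 by rewrite /flat ltNge subr_le0 x1.
by have := smooth_step_den_gt0 x; rewrite /smooth_step f0 addr0 => ?; rewrite divff // gt_eqF.
Qed.

Lemma Ck_on_step n k (W : set 'rV[R]_n) F : open W ->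
  Ck_on k W F -> Ck_on k W (fun u => smooth_step (F u)).
Proof.
move=> oW CF; apply: Ck_onM => //; first exact: Ck_on_flat.
apply: Ck_onV => // [u _|]; first by rewrite gt_eqF // smooth_step_den_gt0.
apply: Ck_onD => //; first exact: Ck_on_flat.
apply: Ck_on_flat => //; apply: Ck_onD => //; first exact: Ck_on_cst.
have := Ck_onM oW (Ck_on_cst k W (-1)) CF.
by apply: Ck_on_eq => // u _; rewrite mulN1r.
Qed.

(** The norm of row vectors is the sup norm, so balls are cubes and a product of one-variable steps
    suffices. Squaring avoids the absolute value: [2 - t ^+ 2] is a polynomial, at least 1 when [t]
    lies in [[-1, 1]] and negative outside [[-2, 2]]. *)
Definition cube_bump n (c : 'rV[R]_n) (r : R) (u : 'rV[R]_n) : R :=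
  \prod_(j < n) smooth_step (2 - ((u 0 j - c 0 j) / r) ^+ 2).

Lemma smooth_cube_bump n (c : 'rV[R]_n) r (W : set 'rV[R]_n) :
  open W -> smooth_on W (cube_bump c r).
Proof.
move=> oW k; apply: Ck_on_prod => // j; apply: Ck_on_step => //.
have C1 : Ck_on k W (fun u : 'rV[R]_n => (u 0 j - c 0 j) / r).
  by apply: Ck_onM (Ck_on_cst _ _ _) => //; apply: Ck_onD (Ck_on_coord _ _ _) (Ck_on_cst _ _ _).
have := Ck_onD oW (Ck_on_cst k W 2) (Ck_onM oW (Ck_on_cst k W (-1)) (Ck_onM oW C1 C1)).
by apply: Ck_on_eq => // u _; rewrite mulN1r expr2.
Qed.

Lemma cube_bump_ge0 n (c : 'rV[R]_n) r u : 0 <= cube_bump c r u.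
Proof. by apply: prodr_ge0 => j _; exact: smooth_step_ge0. Qed.

Lemma cube_bump_le1 n (c : 'rV[R]_n) r u : cube_bump c r u <= 1.
Proof.
suff /andP[] : 0 <= cube_bump c r u <= 1 by [].
apply: (big_ind (fun x => 0 <= x <= 1)) => [|x y /andP[x0 x1] /andP[y0 y1]|j _].
- by rewrite ler01 lexx.
- by rewrite mulr_ge0 // mulr_ile1.
- by rewrite smooth_step_ge0 smooth_step_le1.
Qed.

Lemma cube_bump_eq1 n (c : 'rV[R]_n) r u : 0 < r -> `|u - c| <= r -> cube_bump c r u = 1.
Proof.
move=> r0 uc; rewrite /cube_bump big1 // => j _; apply: smooth_step_eq1.
suff : ((u 0 j - c 0 j) / r) ^+ 2 <= 1 by lra.
rewrite -[_ ^+ 2]real_normK ?num_real // expr_le1 // normrM normfV.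
rewrite (gtr0_norm r0) ler_pdivrMr // mul1r.
by have /(rV_norm_le _ (ltW r0))/(_ j) := uc; rewrite !mxE.
Qed.

Lemma cube_bump_neq0 n (c : 'rV[R]_n) r u : 0 < r -> cube_bump c r u != 0 -> `|u - c| <= 2 * r.
Proof.
move=> r0 /prodf_neq0 b0; apply/rV_norm_le => [|j]; first by rewrite mulr_ge0 // ltW.
rewrite !mxE leNgt; apply/negP => ucj.
have /eqP := b0 j isT; apply; apply: smooth_step_eq0.
rewrite subr_le0 -[_ ^+ 2]real_normK ?num_real // normrM normfV (gtr0_norm r0).
have : 2 <= `|u 0 j - c 0 j| / r by rewrite ler_pdivlMr // ltW.
nra.
Qed.

End SmoothBump.

(** * Smooth functions on manifolds *)

Section SmoothParametrizations.
Context {R : realType}.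

Lemma openI_preimage (T U : topologicalType) (W : set T) (D : set U) (f : T -> U) :
  open W -> open D -> (forall x, W x -> {for x, continuous f}) ->
  open (W `&` f @^-1` D).
Proof.
move=> oW oD cf; rewrite openE => x [Wx Dfx]; apply: filterI.
  exact: open_nbhs_nbhs.
by apply: (cf x Wx); exact: open_nbhs_nbhs.
Qed.

(** Isolated from [is_manifold] because it passes to products chart by chart ([prod_charted]), as
    [mul_param] and [act_param] require for [prod_atlas]. *)
Definition charted (T : topologicalType) n (A : set (chart R T n)) :=
  (forall c, A c -> is_chart c) /\ (forall x, exists2 c, A c & cdom c x).

Lemma manifold_charted (T : topologicalType) n (A : set (chart R T n)) :
  is_manifold A -> charted A.
Proof. by case. Qed.

Lemma cinv_cdom (T : topologicalType) n (c : chart R T n) u :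
  is_chart c -> cimage c setT u -> cdom c (cinv c u) /\ cmap c (cinv c u) = u.
Proof. by move=> [_ _ cK _ _] [x [cx _] <-]; rewrite cK. Qed.

Lemma cimageE (T : topologicalType) n (c : chart R T n) D : is_chart c ->
  cimage c D = cimage c setT `&` cinv c @^-1` D.
Proof.
move=> cc; have [_ _ cK _ _] := cc; apply/seteqP; split.
  by move=> _ [x [cx Dx] <-]; split; [exists x|rewrite /= cK].
by move=> u [/(cinv_cdom cc)[cu uE] Du]; exists (cinv c u).
Qed.

Lemma open_cimage (T : topologicalType) n (c : chart R T n) D :
  is_chart c -> open D -> open (cimage c D).
Proof.
by move=> cc oD; rewrite cimageE //; have [_ oc _ _ ci] := cc; exact: openI_preimage.
Qed.

Lemma cmap_cimage (T : topologicalType) n (c : chart R T n) x :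
  cdom c x -> cimage c setT (cmap c x).
Proof. by move=> cx; exists x. Qed.

Lemma eq_for_continuous (T U : topologicalType) (f g : T -> U) x :
  f =1 g -> {for x, continuous f} -> {for x, continuous g}.
Proof. by move=> fg; apply: near_eq_continuous; exact: nearW. Qed.

Lemma row_mx_continuous (T : topologicalType) n m (f : T -> 'rV[R]_n) (g : T -> 'rV[R]_m) x :
  {for x, continuous f} -> {for x, continuous g} ->
  {for x, continuous (fun y => row_mx (f y) (g y))}.
Proof.
move=> cf cg; apply: rV_continuous => j; case: (split_ordP j) => i ->.
  apply: (@eq_for_continuous _ _ (fun y => f y 0 i)) => [y|]; first by rewrite row_mxEl.
  by apply: (@continuous_comp _ _ _ f (fun w : 'rV[R]_n => w 0 i)) => //; exact: coord_continuous.
apply: (@eq_for_continuous _ _ (fun y => g y 0 i)) => [y|]; first by rewrite row_mxEr.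
by apply: (@continuous_comp _ _ _ g (fun w : 'rV[R]_m => w 0 i)) => //; exact: coord_continuous.
Qed.

Lemma lsubmx_continuous n m : continuous (lsubmx : 'rV[R]_(n + m) -> 'rV[R]_n).
Proof.
move=> u; apply: rV_continuous => j.
apply: (@eq_for_continuous _ _ (fun y : 'rV[R]_(n + m) => y 0 (lshift m j))) => [y|];
  first by rewrite mxE.
exact: coord_continuous.
Qed.

Lemma rsubmx_continuous n m : continuous (rsubmx : 'rV[R]_(n + m) -> 'rV[R]_m).
Proof.
move=> u; apply: rV_continuous => j.
apply: (@eq_for_continuous _ _ (fun y : 'rV[R]_(n + m) => y 0 (rshift n j))) => [y|];
  first by rewrite mxE.
exact: coord_continuous.
Qed.

Lemma pair_continuous (T U V : topologicalType) (f : T -> U) (g : T -> V) x :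
  {for x, continuous f} -> {for x, continuous g} ->
  {for x, continuous (fun y => (f y, g y))}.
Proof. by move=> cf cg; exact: cvg_pair. Qed.

Lemma prod_is_chart (T U : topologicalType) n m (c : chart R T n) (c' : chart R U m) :
  is_chart c -> is_chart c' -> is_chart (prod_chart c c').
Proof.
move=> cc cc'; have [od oi cK cm ci] := cc; have [od' oi' cK' cm' ci'] := cc'.
have imE : cimage (prod_chart c c') setT =
    (setT `&` lsubmx @^-1` cimage c setT) `&` rsubmx @^-1` cimage c' setT.
  apply/seteqP; split.
    move=> _ [[x y] [[/= cx cy] _] <-]; rewrite /= row_mxKl row_mxKr.
    by split; [split|] => //; exact: cmap_cimage.
  move=> u [[_ /(cinv_cdom cc)[cu uE]] /(cinv_cdom cc')[cv vE]].
  by exists (cinv c (lsubmx u), cinv c' (rsubmx u)); rewrite //= uE vE hsubmxK.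
split.
- rewrite openE => -[x y] [/= cx cy]; exists (cdom c, cdom c') => //.
  by split; exact: open_nbhs_nbhs.
- rewrite imE; apply: openI_preimage oi' _; last by move=> u _; exact: rsubmx_continuous.
  by apply: openI_preimage openT oi _ => u _; exact: lsubmx_continuous.
- by move=> [x y] [/= cx cy]; rewrite row_mxKl row_mxKr cK // cK'.
- move=> [x y] [/= cx cy]; apply: row_mx_continuous.
    apply: (@continuous_comp _ _ _ fst (cmap c)); last exact: cm.
    exact: cvg_fst.
  apply: (@continuous_comp _ _ _ snd (cmap c')); last exact: cm'.
  exact: cvg_snd.
- rewrite imE => u [[_ cu] cv]; apply: pair_continuous.
    by apply: continuous_comp; [exact: lsubmx_continuous|exact: ci].
  by apply: continuous_comp; [exact: rsubmx_continuous|exact: ci'].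
Qed.

Lemma prod_charted (T U : topologicalType) n m (A : set (chart R T n)) (A' : set (chart R U m)) :
  charted A -> charted A' -> charted (prod_atlas A A').
Proof.
move=> [cA xA] [cA' xA']; split.
  by move=> _ [c [c' [/cA cc /cA' cc' ->]]]; exact: prod_is_chart.
move=> [x y]; have [c Ac cx] := xA x; have [c' Ac' cy] := xA' y.
by exists (prod_chart c c') => //; exists c, c'.
Qed.

(* For maps with a Euclidean source, unlike for [smooth_map], composition and
   pairing need no chart on the source. *)
Definition smooth_param (T : topologicalType) n (A : set (chart R T n)) q
    (W : set 'rV[R]_q) (Phi : 'rV[R]_q -> T) : Prop :=
  [/\ open W, (forall u, W u -> {for u, continuous Phi}) &
      forall c, A c -> forall j,
        smooth_on (W `&` Phi @^-1` cdom c) (fun u => cmap c (Phi u) 0 j)].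

Section Param.
Context (T : topologicalType) n (A : set (chart R T n)).
Hypothesis hA : charted A.

Lemma smooth_param_open q (W : set 'rV[R]_q) Phi c :
  smooth_param A W Phi -> A c -> open (W `&` Phi @^-1` cdom c).
Proof.
by move=> [oW cP _] Ac; apply: openI_preimage => //; have [/(_ _ Ac)[]] := hA.
Qed.

Lemma smooth_fun_param q (W : set 'rV[R]_q) Phi f :
  smooth_param A W Phi -> smooth_fun A f -> smooth_on W (f \o Phi).
Proof.
move=> sP sf k; have [oW cP dP] := sP; apply: Ck_on_local => u Wu.
have [c Ac cu] := hA.2 (Phi u).
have oWc := smooth_param_open sP Ac.
have [_ oi cK _ _] := hA.1 _ Ac.
exists (W `&` Phi @^-1` cdom c) => //.
have : Ck_on k (W `&` Phi @^-1` cdom c) (fun u => f (cinv c (cmap c (Phi u)))).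
  apply: (@Ck_on_comp _ _ _ _ _ (cimage c setT) (fun w => f (cinv c w))
    (fun u => cmap c (Phi u))) => //.
  - by move=> v [_ cv]; exact: cmap_cimage.
  - by move=> j; exact: dP.
  - exact: sf.
by apply: Ck_on_eq => // v [_ cv]; rewrite /= cK.
Qed.

Lemma smooth_param_map (T' : topologicalType) n' (A' : set (chart R T' n')) q
    (W : set 'rV[R]_q) Phi F :
  (forall c, A' c -> is_chart c) ->
  smooth_param A W Phi -> smooth_map A A' F -> smooth_param A' W (F \o Phi).
Proof.
move=> cA' sP [cF sF]; have [oW cP dP] := sP; split => //.
  by move=> u Wu; apply: continuous_comp; [exact: cP|exact: cF].
move=> c' Ac' j k; apply: Ck_on_local => u [Wu c'u].
have [c Ac cu] := hA.2 (Phi u).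
have cc := hA.1 _ Ac; have [_ oi cK _ _] := cc.
have oc' : open (cdom c') by have [] := cA' _ Ac'.
have oD : open (F @^-1` cdom c') by apply: open_comp => // *; exact: cF.
have oW' : open (W `&` Phi @^-1` (cdom c `&` F @^-1` cdom c')).
  by apply: openI_preimage => //; apply: openI => //; have [] := cc.
exists (W `&` Phi @^-1` (cdom c `&` F @^-1` cdom c')) => //.
have : Ck_on k (W `&` Phi @^-1` (cdom c `&` F @^-1` cdom c'))
    (fun u => cmap c' (F (cinv c (cmap c (Phi u)))) 0 j).
  apply: (@Ck_on_comp _ _ _ _ _ (cimage c (F @^-1` cdom c'))
    (fun w => cmap c' (F (cinv c w)) 0 j) (fun u => cmap c (Phi u))) => //.
  - exact: open_cimage.
  - by move=> v [_ [cv Fv]]; exists (Phi v).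
  - move=> i; apply: Ck_onS (dP c Ac i k) => v [Wv [cv _]]; split => //.
  - exact: sF.
by apply: Ck_on_eq => // v [_ [cv _]]; rewrite /= cK.
Qed.

Lemma smooth_param_cst q (W : set 'rV[R]_q) x : open W -> smooth_param A W (fun=> x).
Proof.
move=> oW; split=> // [u _|c Ac j k]; first exact: cst_continuous.
exact: Ck_on_cst.
Qed.

Lemma smooth_param_comp q q' (W : set 'rV[R]_q) (W' : set 'rV[R]_q') Phi L :
  open W' -> (forall u, W' u -> W (L u)) ->
  (forall j, smooth_on W' (fun u => L u 0 j)) ->
  smooth_param A W Phi -> smooth_param A W' (Phi \o L).
Proof.
move=> oW' WL sL sP; have [oW cP dP] := sP.
have cL u : W' u -> {for u, continuous L}.
  by move=> Wu; apply: rV_continuous => j; have [+ _] := sL j 0%N; exact.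
split => //.
  by move=> u Wu; apply: continuous_comp; [exact: cL|apply/cP/WL].
move=> c Ac j k.
have oWc := smooth_param_open sP Ac.
apply: (@Ck_on_comp _ _ _ _ _ _ (fun w => cmap c (Phi w) 0 j) L _ oWc) => //.
- have -> : W' `&` (Phi \o L) @^-1` cdom c =
      W' `&` L @^-1` (W `&` Phi @^-1` cdom c).
    by apply/seteqP; split => [v [Wv cv]|v [Wv [_ cv]]] //; split=> //; split => //; exact: WL.
  exact: openI_preimage.
- by move=> v [Wv cv]; split => //; exact: WL.
- by move=> i; apply: Ck_onS (sL i k) => v [].
- exact: dP.
Qed.

End Param.

Lemma smooth_param_cinv (T : topologicalType) n (A : set (chart R T n)) c :
  is_manifold A -> A c -> smooth_param A (cimage c setT) (cinv c).
Proof.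
move=> [_ _ cA _ sA] Ac; have cc := cA _ Ac; have [_ oi _ _ ci] := cc.
split => // c' Ac' j; rewrite -cimageE //; exact: sA.
Qed.

Lemma smooth_param_pair (T T' : topologicalType) n n' (A : set (chart R T n))
    (A' : set (chart R T' n')) q (W : set 'rV[R]_q) Phi Psi :
  smooth_param A W Phi -> smooth_param A' W Psi ->
  smooth_param (prod_atlas A A') W (fun u => (Phi u, Psi u)).
Proof.
move=> [oW cP dP] [_ cQ dQ]; split => //.
  by move=> u Wu; apply: pair_continuous; [exact: cP|exact: cQ].
move=> _ [c [c' [Ac Ac' ->]]] j k /=; apply: Ck_on_row_mx => i.
  by apply: Ck_onS (dP c Ac i k) => u [Wu []].
by apply: Ck_onS (dQ c' Ac' i k) => u [Wu []].
Qed.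

End SmoothParametrizations.

Section SmoothFunctions.
Context {R : realType} (T : topologicalType) (n : nat) (A : set (chart R T n)).
Hypothesis mA : is_manifold A.

Let hA : charted A := manifold_charted mA.

Lemma smooth_fun_continuous f : smooth_fun A f -> continuous f.
Proof.
move=> sf x; have [c Ac cx] := hA.2 x.
have [od oi cK cm _] := hA.1 _ Ac.
apply: (@near_eq_continuous _ _ (fun y => f (cinv c (cmap c y)))).
  by apply: filterS (open_nbhs_nbhs (conj od cx)) => y cy; rewrite cK.
apply: (@continuous_comp _ _ _ (cmap c) (fun u => f (cinv c u))); first exact: cm.
by have [+ _] := sf c Ac 0%N; apply; exact: cmap_cimage.
Qed.

Let oc c : A c -> open (cimage c setT).
Proof. by move=> Ac; have [] := hA.1 _ Ac. Qed.

Lemma smooth_fun_cst (a : R) : smooth_fun A (fun=> a).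
Proof. by move=> c Ac k; exact: Ck_on_cst. Qed.

Lemma smooth_funD f g : smooth_fun A f -> smooth_fun A g -> smooth_fun A (fun x => f x + g x).
Proof. by move=> sf sg c Ac k; apply: Ck_onD; [exact: oc|exact: sf|exact: sg]. Qed.

Lemma smooth_funM f g : smooth_fun A f -> smooth_fun A g -> smooth_fun A (fun x => f x * g x).
Proof. by move=> sf sg c Ac k; apply: Ck_onM; [exact: oc|exact: sf|exact: sg]. Qed.

Let hT : hausdorff_space T.
Proof. by have [] := mA. Qed.

Lemma test_function_supp f (K : set T) : smooth_fun A f -> compact K ->
  (forall x, f x != 0 -> K x) -> test_function A f.
Proof.
move=> sf cK fK; split => //; apply: (subclosed_compact _ cK); first exact: closed_closure.
have /closure_id -> := compact_closed hT cK.
by apply: closureS => x; exact: fK.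
Qed.

Lemma test_function_cst0 : test_function A (fun=> 0).
Proof.
apply: (@test_function_supp _ set0); [exact: smooth_fun_cst|exact: compact0|].
by move=> x; rewrite eqxx.
Qed.

Lemma test_functionD f g : test_function A f -> test_function A g ->
  test_function A (fun x => f x + g x).
Proof.
move=> [sf cf] [sg cg]; apply: test_function_supp (compactU cf cg) _.
  exact: smooth_funD.
move=> x; have [f0|f0] := eqVneq (f x) 0; last by move=> _; left; exact: subset_closure.
by rewrite f0 add0r => gx; right; exact: subset_closure.
Qed.

Lemma test_functionM f g : smooth_fun A f -> test_function A g ->
  test_function A (fun x => f x * g x).
Proof.
move=> sf [sg cg]; apply: test_function_supp cg _; first exact: smooth_funM.
by move=> x; rewrite mulf_eq0 negb_or => /andP[_ gx]; exact: subset_closure.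
Qed.

Lemma test_functionZ (a : R) g : test_function A g -> test_function A (fun x => a * g x).
Proof. by apply: (@test_functionM (fun=> a)); exact: smooth_fun_cst. Qed.

Lemma test_function_sum (I : Type) (r : seq I) f : (forall i, test_function A (f i)) ->
  test_function A (fun x => \sum_(i <- r) f i x).
Proof.
move=> tf; elim: r => [|i r IH].
  by under eq_fun do rewrite big_nil; exact: test_function_cst0.
by under eq_fun do rewrite big_cons; exact: test_functionD.
Qed.

Lemma cube_compact (c : 'rV[R]_n) (r : R) : 0 <= r -> compact [set u : 'rV[R]_n | `|u - c| <= r].
Proof.
move=> r0.
have -> : [set u : 'rV[R]_n | `|u - c| <= r] =
    [set u | forall i, `[c 0 i - r, c 0 i + r]%classic (u ord0 i)].
  apply/seteqP; split => u.
    by move=> /(rV_norm_le _ r0) ur i; have := ur i; rewrite !mxE /= in_itv /= ler_distl.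
  by move=> ur; apply/rV_norm_le => // i; have := ur i; rewrite !mxE /= in_itv /= ler_distl.
apply: (@rV_compact _ n (fun i => `[c 0 i - r, c 0 i + r]%classic)) => i.
exact: segment_compact.
Qed.

(** On the chart domain the extension is [b] after a transition map. Elsewhere, [b] lives on a cube
    whose image under [cinv c] is compact, hence closed as [T] is Hausdorff, and the extension
    vanishes on the open complement. *)
Lemma chart_extend c c0 r b : A c -> 0 <= r ->
  [set u | `|u - c0| <= r] `<=` cimage c setT ->
  smooth_on (cimage c setT) b -> (forall u, b u != 0 -> `|u - c0| <= r) ->
  test_function A (fun y => if y \in cdom c then b (cmap c y) else 0).
Proof.
move=> Ac r0 sQ sb bQ; have cc := hA.1 _ Ac; have [od oi cK cm ci] := cc.
set Q := [set u | _] in sQ.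
have cQ : compact (cinv c @` Q).
  apply: continuous_compact; last exact: cube_compact.
  apply: continuous_in_subspaceT => u.
  by rewrite inE => /sQ/ci.
have supp y : (if y \in cdom c then b (cmap c y) else 0) != 0 -> (cinv c @` Q) y.
  case: ifPn => [|_]; last by rewrite eqxx.
  by rewrite inE => cy /bQ Qy; exists (cmap c y) => //; rewrite cK.
apply: (test_function_supp _ cQ supp) => c' Ac' k.
apply: (@Ck_on_local R n k (cimage c' setT)) => u iu; have cc' := hA.1 _ Ac'.
have [cy|ncy] := pselect (cdom c (cinv c' u)).
  exists (cimage c' (cdom c)); first by rewrite cimageE.
  have : Ck_on k (cimage c' (cdom c)) (fun u => b (cmap c (cinv c' u))).
    apply: (@Ck_on_comp _ _ _ _ _ (cimage c setT) b (fun u => cmap c (cinv c' u))) => //.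
    - exact: open_cimage.
    - by move=> v; rewrite cimageE // => -[_ cv]; exact: cmap_cimage.
    - by have [_ _ _ _ sA] := mA; move=> j; exact: sA.
  apply: Ck_on_eq; first exact: open_cimage.
  move=> v; rewrite cimageE // => -[_ cv].
  by rewrite (mem_set (cv : cdom c (cinv c' v))).
have oK : open (~` (cinv c @` Q)) by exact: closed_openC (compact_closed hT cQ).
exists (cimage c' (~` (cinv c @` Q))).
  rewrite cimageE //; split => // -[v Qv vE]; apply: ncy; rewrite -vE.
  by have [] := cinv_cdom cc (sQ _ Qv).
apply: Ck_on_eq (Ck_on_cst k _ 0); first exact: open_cimage.
move=> v; rewrite cimageE // => -[_ nKv].
by apply/esym/eqP; apply/negP => /negP/supp.
Qed.

(** The localized coordinates accompany the bump because an [exponential_curve] can be tested only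
    against globally smooth functions. *)
Lemma chart_bump c x : A c -> cdom c x ->
  exists r : R, [/\ 0 < r, [set u | `|u - cmap c x| <= 2 * r] `<=` cimage c setT,
    test_function A (fun y => if y \in cdom c then cube_bump (cmap c x) r (cmap c y) else 0) &
    forall j, test_function A (fun y => if y \in cdom c then
       cube_bump (cmap c x) r (cmap c y) * cmap c y 0 j else 0)].
Proof.
move=> Ac cx; have cc := hA.1 _ Ac; have [od oi cK cm ci] := cc.
have /nbhs_ballP[d /= d0 dW] := near_open oi (cmap_cimage cx).
(* The cube carrying the bump has radius [2 * (d / 4) = d / 2], hence lies in the open ball of
   radius [d]. *)
have r0 : 0 < d / 4 by rewrite divr_gt0.
have sQ : [set u | `|u - cmap c x| <= 2 * (d / 4)] `<=` cimage c setT.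
  move=> u /= ur; apply: dW; rewrite -ball_normE /= distrC (le_lt_trans ur) //; lra.
have r20 : 0 <= 2 * (d / 4) by lra.
exists (d / 4); split => // [|j].
  apply: (chart_extend Ac r20 sQ); first exact: smooth_cube_bump.
  by move=> u; exact: cube_bump_neq0.
apply: (@chart_extend c _ _ (fun u => cube_bump (cmap c x) (d / 4) u * u 0 j) Ac r20 sQ).
  by move=> k; apply: Ck_onM => //; [exact: smooth_cube_bump|exact: Ck_on_coord].
by move=> u; rewrite mulf_eq0 negb_or => /andP[+ _]; exact: cube_bump_neq0.
Qed.

Lemma test_bump (x : T) : exists f : T -> R, [/\ test_function A f, (forall y, 0 <= f y <= 1) &
  \forall y \near x, f y = 1].
Proof.
have [c Ac cx] := hA.2 x; have [od oi cK cm ci] := hA.1 _ Ac.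
have [r [r0 _ tf _]] := chart_bump Ac cx.
exists (fun y => if y \in cdom c then cube_bump (cmap c x) r (cmap c y) else 0); split=> //.
  by move=> y; case: ifP => _; rewrite ?lexx ?ler01 // cube_bump_ge0 cube_bump_le1.
have n1 : \forall y \near x, cdom c y by apply: open_nbhs_nbhs.
have n2 : \forall y \near x, `|cmap c y - cmap c x| <= r.
  by have /cvgrPdist_le/(_ r r0) := cm x cx; apply: filterS => y; rewrite distrC.
by apply: filterS2 n1 n2 => y cy yr; rewrite (mem_set cy) cube_bump_eq1.
Qed.

(** Each point has a basic open neighbourhood on which some bump equals 1. Choosing one bump per
    such basic set leaves countably many, numbered by an injection [f] of the basis into the
    naturals. *)
Lemma countable_bumps : exists theta : nat -> T -> R,
  [/\ forall q, test_function A (theta q), forall q y, 0 <= theta q y <= 1 &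
    forall x : T, exists q, \forall y \near x, theta q y = 1].
Proof.
have [_ [B cB [oB bB]] _ _ _] := mA.
have /countable_injP[f injf] := cB.
pose good U t := [/\ test_function A t, (forall y, 0 <= t y <= 1) & forall y, U y -> t y = 1].
have H q : exists t : T -> R, [/\ test_function A t, (forall y, 0 <= t y <= 1) &
    forall U, B U -> f U = q -> (exists t', good U t') -> forall y, U y -> t y = 1].
  have [[U [BU fU [t gt]]]|no] := pselect (exists U, [/\ B U, f U = q & exists t, good U t]).
    exists t; have [tt t01 tU] := gt; split => // U' BU' fU' _.
    have -> // : U' = U by apply: injf; rewrite ?inE // fU.
  (* When [q] numbers no basic set admitting a bump, the last clause is vacuous and the zero
     function serves. *)
  exists (fun=> 0); split; first exact: test_function_cst0.
    by move=> y; rewrite lexx ler01.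
  by move=> U BU fU ex; exfalso; apply: no; exists U.
have [theta Htheta] := choice H; exists theta; split;
  [by move=> q; have [] := Htheta q|by move=> q; have [] := Htheta q|].
move=> x; have [t [tt t01 t1]] := test_bump x.
have [U [BU Ux] Ut] := bB x _ t1.
exists (f U); have [_ _ /(_ U BU erefl)] := Htheta (f U).
move=> /(_ (ex_intro _ t (And3 tt t01 Ut))) H1.
by apply: filterS H1 _; apply: open_nbhs_nbhs; split => //; exact: oB.
Qed.

(** The recursion is [1 - (1 - psi) * (1 - theta)]: once some [theta q] equals 1 at a point, all
    later cutoffs do. The last clause is locally uniform in [x], the form used by the compactness
    argument in [bounded_cutoffs]. *)
Lemma cutoffs : exists psi : nat -> T -> R,
  [/\ forall k, test_function A (psi k), forall k y, 0 <= psi k y <= 1 &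
    forall x : T, \forall y \near x & k \near \oo, \forall z \near y, psi k z = 1].
Proof.
have [theta [tt t01 t1]] := countable_bumps.
pose psi := fix psi k := if k is k'.+1 then
  fun y => psi k' y + (theta k' y + (-1) * (psi k' y * theta k' y)) else fun=> 0.
have psiS k y : psi k.+1 y = psi k y + (theta k y + (-1) * (psi k y * theta k y)) by [].
have tpsi k : test_function A (psi k).
  elim: k => [|k IH]; first exact: test_function_cst0.
  apply: test_functionD => //; apply: test_functionD => //; apply: test_functionZ.
  by apply: test_functionM => //; have [] := IH.
have psi01 k y : 0 <= psi k y <= 1.
  elim: k => [|k /andP[p0 p1]]; first by rewrite lexx ler01.
  by rewrite psiS; have /andP[q0 q1] := t01 k y; apply/andP; split; nra.
exists psi; split => // x; have [q qx] := t1 x.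
have psi1 k y : theta q y = 1 -> (q < k)%N -> psi k y = 1.
  move=> ty; elim: k => [//|k IH]; rewrite ltnS leq_eqVlt psiS => /orP[/eqP <-|/IH ->].
    by rewrite ty; ring.
  by ring.
exists ([set y | \forall z \near y, theta q z = 1], [set k | (q < k)%N]).
  by split; [exact: nbhs_interior|exists q.+1].
move=> [y k] [/= yq qk].
by near=> z; apply: psi1 => //; near: z.
Unshelve. all: by end_near. Qed.

End SmoothFunctions.

(** * The group action *)

Section GroupAction.
Context {R : realType} (G : ptopologicalGroupType) (n : nat) (AG : set (chart R G n)).
Hypothesis G_lie : lie_group AG.
Context (M : ptopologicalType) (m : nat) (AM : set (chart R M m)).
Hypothesis mM : is_manifold AM.
Variable act : G -> M -> M.
Hypothesis act_smooth : smooth_right_action AG AM act.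

Let mG : is_manifold AG.
Proof. by have [] := G_lie. Qed.

Let hG : charted AG := manifold_charted mG.
Let hM : charted AM := manifold_charted mM.

Lemma act_param q (W : set 'rV[R]_q) Phi Psi :
  smooth_param AG W Phi -> smooth_param AM W Psi ->
  smooth_param AM W (fun u => act (Phi u) (Psi u)).
Proof.
move=> sP sQ; have [_ _ sact] := act_smooth.
exact: (smooth_param_map (prod_charted hG hM) hM.1 (smooth_param_pair sP sQ) sact).
Qed.

Lemma mul_param q (W : set 'rV[R]_q) Phi Psi :
  smooth_param AG W Phi -> smooth_param AG W Psi ->
  smooth_param AG W (fun u => Phi u * Psi u)%g.
Proof.
move=> sP sQ; have [_ smul _] := G_lie.
exact: (smooth_param_map (prod_charted hG hG) hG.1 (smooth_param_pair sP sQ) smul).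
Qed.

Lemma act_continuous g : continuous (act g).
Proof.
have [_ _ [cact _]] := act_smooth.
move=> x; apply: (@continuous_comp _ _ _ (fun y => (g, y)) (fun z : G * M => act z.1 z.2)).
  by apply: pair_continuous; [exact: cst_continuous|exact: cvg_id].
exact: cact.
Qed.

Lemma act_invK g x : act g^-1%g (act g x) = x.
Proof.
by have [act1 actM _] := act_smooth; rewrite -actM mulgV act1.
Qed.

Lemma smooth_fun_act g f : smooth_fun AM f -> smooth_fun AM (fun x => f (act g x)).
Proof.
move=> sf c Ac; have [_ oi _ _ _] := hM.1 _ Ac.
apply: (smooth_fun_param hM _ sf (Phi := fun u => act g (cinv c u))).
apply: act_param; last exact: smooth_param_cinv.
exact: smooth_param_cst.
Qed.

Lemma test_function_act g f : test_function AM f -> test_function AM (fun x => f (act g x)).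
Proof.
move=> [sf cf]; apply: (test_function_supp mM (K := act g^-1%g @` closure [set x | f x != 0])).
- exact: smooth_fun_act.
- by apply: continuous_compact cf; apply: continuous_subspaceT; exact: act_continuous.
- by move=> x fx; exists (act g x); [exact: subset_closure|exact: act_invK].
Qed.

Section ExponentialCurve.
Variables (Z : (G -> R) -> G -> R) (gamma : R -> G).
Hypothesis gamma_exp : exponential_curve AG Z gamma.
Variable c : chart R G n.
Hypothesis Ac : AG c.
Hypothesis c1 : cdom c 1%g.

(** Where the bump is nonzero along the curve, [gamma s] must lie in the chart, and there each
    coordinate is the quotient of the localized coordinate by the bump. Both are smooth on all of
    [G], so their derivatives along [gamma] exist by hypothesis. *)
Lemma exponential_curve_chart : (\forall s \near (0 : R), cdom c (gamma s)) /\
  forall j, derivable (fun s : R => cmap c (gamma s) 0 j) (0 : R) 1.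
Proof.
have [g0 dg] := gamma_exp.
have [r [r0 _ [sth _] syj]] := chart_bump mG Ac c1.
set th := fun y => _ in sth.
pose y j := fun g => if g \in cdom c then cube_bump (cmap c 1%g) r (cmap c g) * cmap c g 0 j else 0.
have dth : derivable (fun s => th (gamma s)) (0 : R) 1 by have [] := dg _ sth 0.
have dy j : derivable (fun s => y j (gamma s)) (0 : R) 1.
  by have [sy _] := syj j; have [] := dg _ sy 0.
have th0 : th (gamma 0) = 1.
  by rewrite g0 /th (mem_set c1) cube_bump_eq1 // subrr normr0 ltW.
have nth : \forall s \near (0 : R), th (gamma s) != 0.
  have /derivable1_diffP/differentiable_continuous := dth.
  rewrite /prop_for /continuous_at th0 => /cvgrPdist_lt/(_ 1 ltr01).
  apply: filterS => s; apply: contraTneq => ->.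
  by rewrite subr0 normr1 ltxx.
have nc : \forall s \near (0 : R), cdom c (gamma s).
  apply: filterS nth => s; rewrite /th; case: ifPn => [|_]; first by rewrite inE.
  by rewrite eqxx.
split; [exact: nc|move=> j].
apply: (@near_eq_derivable _ _ _ (fun s => y j (gamma s) * (th (gamma s))^-1)).
  apply: filterS2 nth nc => s; rewrite /th /y => + cs.
  by rewrite (mem_set cs) => b0; rewrite mulrAC mulfV // mul1r.
apply: derivableM; first exact: dy.
by apply: derivableV; [rewrite th0 oner_neq0|exact: dth].
Qed.

Let u1 := cmap c 1%g.
Let W := cimage c setT.

(* [b j u] are the components in the chart [c] of the right-invariant field
   generated by the curve: [d/ds cmap c (gamma s * cinv c u)] at [s = 0]. *)
Lemma exponential_curve_field : exists b : 'I_n -> 'rV[R]_n -> R,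
  (forall j, smooth_on W (b j)) /\
  forall psi, smooth_fun AM psi -> forall x u, W u ->
    is_derive (0 : R) (1 : R) (fun s : R => psi (act (cinv c u) (act (gamma s) x)))
      (\sum_j b j u * 'D_(delta_mx 0 j) (fun w => psi (act (cinv c w) x)) u).
Proof.
have [nc dc] := exponential_curve_chart.
have [g0 _] := gamma_exp; have [act1 actM _] := act_smooth.
have cc := hG.1 _ Ac; have [od oi cK cm ci] := cc.
have sc := smooth_param_cinv mG Ac.
pose beta j := 'D_1 (fun s : R => cmap c (gamma s) 0 j) 0.
(* Multiplication is read in coordinates: a pair of group elements of the chart is one row of length
   [n + n]. *)
pose S := [set z : 'rV[R]_(n + n) | W (lsubmx z) /\ W (rsubmx z)].
have oS : open S.
  have := openI_preimage (openI_preimage openT oi (fun u _ => @lsubmx_continuous R n n u))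
    oi (fun u _ => @rsubmx_continuous R n n u).
  by congr open; apply/seteqP; split => [z [[]]|z []].
have sl : smooth_param AG S (fun z => cinv c (lsubmx z)).
  apply: (smooth_param_comp hG oS _ _ sc (L := lsubmx)) => [z []//|j k].
  by apply: Ck_on_eq (Ck_on_coord k S (lshift n j)) => // z _; rewrite mxE.
have sr : smooth_param AG S (fun z => cinv c (rsubmx z)).
  apply: (smooth_param_comp hG oS _ _ sc (L := rsubmx)) => [z []//|j k].
  by apply: Ck_on_eq (Ck_on_coord k S (rshift n j)) => // z _; rewrite mxE.
have sm := mul_param sl sr.
pose mul (z : 'rV[R]_(n + n)) := (cinv c (lsubmx z) * cinv c (rsubmx z))%g.
have [_ _ /(_ c Ac) dm] := sm.
have oSc := smooth_param_open hG sm Ac.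
set Sc := S `&` _ in dm oSc.
have Sc1 u : W u -> Sc (row_mx u1 u).
  move=> Wu; split; first by rewrite /S /= row_mxKl row_mxKr; split => //; exact: cmap_cimage.
  by rewrite /= row_mxKl row_mxKr /u1 cK // mul1g; have [] := cinv_cdom cc Wu.
(* In the derivative of [gamma s * cinv c u] at [s = 0] only the left factor moves, so only the
   first [n] partial derivatives of the product appear, weighted by the velocity [beta] of the
   curve. *)
pose b j u := \sum_l 'D_(delta_mx 0 (lshift n l)) (fun z => cmap c (mul z) 0 j)
  (row_mx u1 u) * beta l.
exists b; split.
  move=> j k; apply: Ck_on_sum => // l; apply: Ck_onM (Ck_on_cst _ _ _) => //.
  apply: (@Ck_on_comp _ _ _ _ _ Sc
    ('D_(delta_mx 0 (lshift n l)) (fun z => cmap c (mul z) 0 j)) (fun u => row_mx u1 u)) => //.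
    by apply: Ck_on_row_mx => i; [exact: Ck_on_cst|exact: Ck_on_coord].
  by have [_ /(_ (lshift n l))[]] := dm j k.+1.
move=> psi spsi x u Wu.
have db j : is_derive (0 : R) (1 : R) (fun s : R => cmap c (gamma s * cinv c u)%g 0 j) (b j u).
  have Cw : Ck_on 1 Sc (fun z => cmap c (mul z) 0 j) by exact: dm.
  have := @is_derive_comp_rV _ _ _ Sc (fun z => cmap c (mul z) 0 j)
    (fun s : R => row_mx (cmap c (gamma s)) u) 0 1 (row_mx (\row_l beta l) 0) oSc.
  rewrite g0 => /(_ (Sc1 u Wu) Cw).
  have dPhi i : is_derive (0 : R) (1 : R) (fun s : R => row_mx (cmap c (gamma s)) u 0 i)
      ((row_mx (\row_l beta l) 0 : 'rV[R]_(n + n)) 0 i).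
    case: (split_ordP i) => l ->.
      rewrite row_mxEl mxE.
      have -> : (fun s : R => row_mx (cmap c (gamma s)) u 0 (lshift n l)) =
        (fun s => cmap c (gamma s) 0 l) by apply/funext => s; rewrite row_mxEl.
      exact: derivableP.
    rewrite row_mxEr mxE.
    have -> : (fun s : R => row_mx (cmap c (gamma s)) u 0 (rshift n l)) = cst (u 0 l).
      by apply/funext => s; rewrite row_mxEr.
    exact: is_derive_cst.
  move=> /(_ dPhi) H.
  apply: (@near_eq_is_derive _ _ _ (fun s : R =>
    cmap c (mul (row_mx (cmap c (gamma s)) u)) 0 j)).
    apply: filterS nc => s cs.
    by rewrite /mul row_mxKl row_mxKr cK.
  apply: is_derive_eq H _.
  rewrite big_split_ord /= [X in _ + X]big1 ?addr0 => [|l _]; last first.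
    by rewrite row_mxEr mxE mulr0.
  by apply: eq_bigr => l _; rewrite row_mxEl mxE.
have sF : smooth_on W (fun w => psi (act (cinv c w) x)).
  apply: (smooth_fun_param hM _ spsi (Phi := fun w => act (cinv c w) x)).
  by apply: act_param => //; exact: smooth_param_cst.
have [cu uE] := cinv_cdom cc Wu.
have := @is_derive_comp_rV _ _ _ W (fun w => psi (act (cinv c w) x))
    (fun s : R => cmap c (gamma s * cinv c u)%g) 0 1 (\row_j b j u) oi.
rewrite g0 mul1g uE => /(_ Wu (sF 1%N)).
have db' j : is_derive (0 : R) (1 : R) (fun s : R => cmap c (gamma s * cinv c u)%g 0 j)
  ((\row_j b j u) 0 j) by rewrite mxE.
move=> /(_ db') H.
apply: (@near_eq_is_derive _ _ _ (fun s : R =>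
    psi (act (cinv c (cmap c (gamma s * cinv c u)%g)) x))); last first.
  by apply: is_derive_eq H _; apply: eq_bigr => j _; rewrite mxE mulrC.
(* For small [s] the product [gamma s * cinv c u] stays in the chart, by continuity at [s = 0],
   where it is [cinv c u]. There [cinv c] undoes [cmap c], and [actM] splits the action into its two
   factors. *)
have cmu : {for (0 : R), continuous (fun s : R => mul (row_mx (cmap c (gamma s)) u))}.
  apply: (@continuous_comp _ _ _ (fun s : R => row_mx (cmap c (gamma s)) u) mul); last first.
    have [_ + _] := sm; rewrite g0; apply.
    by have [] := Sc1 u Wu.
  apply: row_mx_continuous; last exact: cst_continuous.
  apply: rV_continuous => j; apply: differentiable_continuous.
  by apply/derivable1_diffP; exact: dc.
have nmu : \forall s \near (0 : R), cdom c (mul (row_mx (cmap c (gamma s)) u)).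
  apply: cmu; apply: open_nbhs_nbhs; split => //.
  by rewrite g0; have [] := Sc1 u Wu.
apply: filterS2 nc nmu => s cs; rewrite /mul row_mxKl row_mxKr cK // => cmus.
by rewrite cK // actM.
Qed.

End ExponentialCurve.

End GroupAction.

(** * Cutoffs with bounded derivatives *)

Section GridAverages.
Context {R : realType} (n N : nat).

Definition set_coord (k : {ffun 'I_n -> 'I_N}) (j : 'I_n) (l : 'I_N) : {ffun 'I_n -> 'I_N} :=
  [ffun i => if i == j then l else k i].

(** Each line in direction [j] is counted once for each of its [N] points. The involution [phi],
    exchanging [l] with the [j]-th entry of [k], turns this into a reindexing. *)
Lemma sum_lines (j : 'I_n) (a : {ffun 'I_n -> 'I_N} -> R) :
  \sum_k \sum_l a (set_coord k j l) = N%:R * \sum_k a k.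
Proof.
rewrite pair_bigA /=.
pose phi (p : {ffun 'I_n -> 'I_N} * 'I_N) := (set_coord p.1 j p.2, p.1 j).
have phiK : involutive phi.
  move=> [k l]; rewrite /phi /=; congr (_, _); last by rewrite ffunE eqxx.
  by apply/ffunP => i; rewrite !ffunE; case: eqP => // ->.
transitivity (\sum_p a (phi p).1) => //.
rewrite -(reindex_inj (inv_inj phiK) (P := xpredT) (F := fun p => a p.1)) /=.
rewrite -(pair_bigA _ (fun k _ => a k)) /= mulr_sumr.
by apply: eq_bigr => k _; rewrite sumr_const card_ord mulr_natl.
Qed.

Lemma sum_lines_le (j : 'I_n) (a : {ffun 'I_n -> 'I_N} -> R) (E : R) : (0 < N)%N ->
  (forall k, `|\sum_l a (set_coord k j l)| <= N%:R * E) ->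
  `|\sum_k a k| <= (N ^ n)%:R * E.
Proof.
move=> N0 aE; have N0' : 0 < N%:R :> R by rewrite ltr0n.
rewrite -(ler_pM2l N0') -{1}(gtr0_norm N0') -normrM -(sum_lines j).
apply: le_trans (ler_norm_sum _ _ _) _.
apply: le_trans (ler_sum _ (fun k _ => aE k)) _.
by rewrite sumr_const card_ffun !card_ord -[leLHS]mulr_natl [leRHS]mulrCA.
Qed.

(** Summation by parts moves the differences onto [be], so that only the size of [f] enters, not its
    increments; this makes the bound uniform over all cutoffs with values in [[0, 1]]. *)
Lemma abel_bound (be f : nat -> R) (B h : R) :
  (forall l, (l <= N)%N -> `|be l| <= B) -> (forall l, (l <= N)%N -> `|f l| <= 1) ->
  (forall l, (l < N)%N -> `|be l.+1 - be l| <= B * h) ->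
  `|\sum_(l < N) be l * (f l.+1 - f l)| <= 2 * B + N%:R * (B * h).
Proof.
move=> beB f1 dbe.
have -> : \sum_(l < N) be l * (f l.+1 - f l) = (be N * f N - be 0%N * f 0%N) -
    \sum_(l < N) (be l.+1 - be l) * f l.+1.
  rewrite -(telescope_sumr (fun l => be l * f l)) // big_mkord -sumrB.
  by apply: eq_bigr => l _; ring.
have bf l : (l <= N)%N -> `|be l * f l| <= B.
  move=> lN; rewrite normrM -[B]mulr1; apply: ler_pM => //; [exact: beB|exact: f1].
apply: le_trans (ler_normB _ _) _; apply: lerD.
  apply: le_trans (ler_normB _ _) _.
  by rewrite mulr_natl mulr2n; apply: lerD; exact: bf.
apply: le_trans (ler_norm_sum _ _ _) _.
rewrite mulr_natl -[N in _ *+ N]card_ord -sumr_const; apply: ler_sum => l _.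
rewrite normrM -[B * h]mulr1; apply: ler_pM => //; [exact: dbe|exact: f1].
Qed.

End GridAverages.

Section CompactBounds.
Context {R : realType}.

Lemma compact_bound (T : topologicalType) (K : set T) (f : T -> R) : compact K ->
  (forall x, K x -> {for x, continuous f}) -> exists2 B : R, 0 < B & forall x, K x -> `|f x| <= B.
Proof.
move=> cK cf.
have /ex_strict_bound_gt0[B B0 fB] : bounded_set (f @` K).
  apply: compact_bounded; apply: continuous_compact cK.
  by apply: continuous_in_subspaceT => x; rewrite inE => /cf.
by exists B => // x Kx; apply/ltW/fB; exists x.
Qed.

Lemma finite_bound (I : finType) (T : Type) (K : set T) (f : I -> T -> R) :
  (forall i, exists2 B : R, 0 < B & forall x, K x -> `|f i x| <= B) ->
  exists2 B : R, 0 < B & forall i x, K x -> `|f i x| <= B.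
Proof.
move=> fB; have {fB} /choice[B HB] : forall i, exists B : R,
  0 < B /\ forall x, K x -> `|f i x| <= B.
  by move=> i; have [B B0 HB] := fB i; exists B.
have B0 i : 0 < B i by have [] := HB i.
exists (1 + \sum_i B i).
  by rewrite ltr_pwDl // sumr_ge0 // => i _; exact: ltW.
move=> i x Kx; have [_ /(_ x Kx)fx] := HB i.
apply: (le_trans fx); rewrite (bigD1 i) //= addrCA lerDl.
by rewrite addr_ge0 // sumr_ge0 // => j _; exact: ltW.
Qed.

Lemma derive_lshift n p (f : 'rV[R]_(n + p) -> R) u v j :
  'D_(delta_mx 0 (lshift p j)) f (row_mx u v) =
  'D_(delta_mx 0 j) (fun w : 'rV[R]_n => f (row_mx w v)) u.
Proof.
rewrite /derive; suff -> : (fun h : R => h^-1 *: ((f \o shift (row_mx u v))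
    (h *: delta_mx 0 (lshift p j)) - f (row_mx u v))) =
  (fun h : R => h^-1 *: (((fun w : 'rV[R]_n => f (row_mx w v)) \o shift u)
    (h *: delta_mx 0 j) - f (row_mx u v))) by [].
apply/funext => h /=; congr (_ *: (f _ - _)).
apply/rowP => i; case: (split_ordP i) => l ->; rewrite [LHS]mxE.
  by rewrite !row_mxEl !mxE eq_lshift.
by rewrite !row_mxEr !mxE eq_rlshift mulr0 add0r.
Qed.

Lemma is_derive_big (V : normedModType R) (I : Type) (r : seq I) (f : I -> V -> R) df x v :
  (forall i, is_derive x v (f i) (df i)) ->
  is_derive x v (fun y => \sum_(i <- r) f i y) (\sum_(i <- r) df i).
Proof.
move=> Hf; elim: r => [|i r IH].
  rewrite big_nil (_ : (fun y => _) = cst 0); last by apply/funext => y; rewrite big_nil.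
  exact: is_derive_cst.
rewrite big_cons (_ : (fun y => _) = f i + (fun y => \sum_(i <- r) f i y)).
  exact: is_deriveD.
by apply/funext => y; rewrite big_cons.
Qed.

End CompactBounds.

(** * Orbit functions and the uniform bound on their second derivatives *)

Section OrbitMaps.
Context {R : realType} (G : ptopologicalGroupType) (n : nat) (AG : set (chart R G n)).
Hypothesis G_lie : lie_group AG.
Context (M : ptopologicalType) (m : nat) (AM : set (chart R M m)).
Hypothesis mM : is_manifold AM.
Variable act : G -> M -> M.
Hypothesis act_smooth : smooth_right_action AG AM act.

Let mG : is_manifold AG.
Proof. by have [] := G_lie. Qed.

Let hG : charted AG := manifold_charted mG.
Let hM : charted AM := manifold_charted mM.

Variable c : chart R G n.
Hypothesis Ac : AG c.

Let W := cimage c setT.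

Let oW : open W.
Proof. by have [] := hG.1 _ Ac. Qed.

Lemma orbit_smooth psi x : smooth_fun AM psi ->
  smooth_on W (fun u => psi (act (cinv c u) x)).
Proof.
move=> spsi; apply: (smooth_fun_param hM _ spsi (Phi := fun w => act (cinv c w) x)).
apply: (act_param G_lie mM act_smooth); first exact: smooth_param_cinv.
exact: smooth_param_cst.
Qed.

Lemma orbit_continuous x u : W u -> {for u, continuous (fun v => act (cinv c v) x)}.
Proof.
move=> Wu; have [_ + _] := act_param G_lie mM act_smooth (smooth_param_cinv mG Ac)
  (smooth_param_cst AM x oW).
exact.
Qed.

(** The bound is uniform over the possibly noncompact [M]: only the [x] in a compact set [K']
    matter, and there joint continuity in [u] and [x] suffices. *)
Lemma second_derivative_bound (u1 : 'rV[R]_n) (r : R) psi : 0 < r ->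
  [set u | `|u - u1| <= 2 * r] `<=` W -> test_function AM psi ->
  exists2 L : R, 0 < L & forall j x u, `|u - u1| <= r ->
    `|'D_(delta_mx 0 j) ('D_(delta_mx 0 j) (fun w => psi (act (cinv c w) x))) u| <= L.
Proof.
move=> r0 QW [spsi cpsi]; set K := closure _ in cpsi.
have [act1 actM [cact _]] := act_smooth.
pose F x u := psi (act (cinv c u) x).
pose DD j (z : 'rV[R]_n * M) := 'D_(delta_mx 0 j) ('D_(delta_mx 0 j) (F z.2)) z.1.
have cDD j z : W z.1 -> {for z, continuous (DD j)}.
  move=> Wz; have [c' Ac' cz] := hM.2 z.2.
  have cc' := hM.1 _ Ac'; have [od' oi' cK' cm' ci'] := cc'.
  pose S := [set w : 'rV[R]_(n + m) | W (lsubmx w) /\ cimage c' setT (rsubmx w)].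
  have oS : open S.
    have := openI_preimage (openI_preimage openT oW (fun u _ => @lsubmx_continuous R n m u))
      oi' (fun u _ => @rsubmx_continuous R n m u).
    by congr open; apply/seteqP; split => [w [[]]|w []].
  (* With a chart [c'] of [M] the orbit function becomes a smooth function of [n + m] variables;
     [DD j] is one of its partial derivatives, hence jointly continuous. *)
  pose Psi (w : 'rV[R]_(n + m)) := psi (act (cinv c (lsubmx w)) (cinv c' (rsubmx w))).
  have sPsi : smooth_on S Psi.
    apply: (smooth_fun_param hM _ spsi
      (Phi := fun w => act (cinv c (lsubmx w)) (cinv c' (rsubmx w)))).
    apply: (act_param G_lie mM act_smooth).
      apply: (smooth_param_comp hG oS _ _ (smooth_param_cinv mG Ac) (L := lsubmx)) => [w []//|i k].
      by apply: Ck_on_eq (Ck_on_coord k S (lshift m i)) => // w _; rewrite mxE.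
    apply: (smooth_param_comp hM oS _ _ (smooth_param_cinv mM Ac') (L := rsubmx)) => [w []//|i k].
    by apply: Ck_on_eq (Ck_on_coord k S (rshift n i)) => // w _; rewrite mxE.
  pose e : 'rV[R]_(n + m) := delta_mx 0 (lshift m j).
  have DDE y : cdom c' y.2 -> 'D_e ('D_e Psi) (row_mx y.1 (cmap c' y.2)) = DD j y.
    move=> cy; rewrite /e derive_lshift /DD.
    have -> : (fun w => 'D_(delta_mx 0 (lshift m j)) Psi (row_mx w (cmap c' y.2))) =
        'D_(delta_mx 0 j) (F y.2).
      apply/funext => w; rewrite derive_lshift.
      have -> // : (fun w => Psi (row_mx w (cmap c' y.2))) = F y.2.
      by apply/funext => w'; rewrite /Psi row_mxKl row_mxKr cK'.
    by [].
  apply: (@near_eq_continuous _ _ (fun y => 'D_e ('D_e Psi) (row_mx y.1 (cmap c' y.2)))).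
    have : \forall y \near z, cdom c' y.2.
      by apply: (@cvg_snd _ _ _ _ (nbhs_filter _)); exact: open_nbhs_nbhs.
    by apply: filterS => y; exact: DDE.
  apply: (@continuous_comp _ _ _ (fun y => row_mx y.1 (cmap c' y.2)) ('D_e ('D_e Psi))).
    apply: row_mx_continuous; first exact: cvg_fst.
    by apply: (@continuous_comp _ _ _ snd (cmap c')); [exact: cvg_snd|exact: cm'].
  have [_ /(_ (lshift m j))[_ [_ /(_ (lshift m j))[_ [+ _]]]]] := sPsi 2%N; apply.
  by rewrite /S /= row_mxKl row_mxKr; split => //; exact: cmap_cimage.
pose Q2 := [set u : 'rV[R]_n | `|u - u1| <= 2 * r].
pose Q := [set u : 'rV[R]_n | `|u - u1| <= r].
have cQ : compact Q by apply: cube_compact; exact: ltW.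
have cQ2 : compact Q2 by apply: cube_compact; rewrite mulr_ge0 // ltW.
(* The points that some translation from the larger cube sends into the support. For [x] outside
   [K'] the orbit function vanishes on the cube of radius [2 * r], hence near every point of the
   smaller cube, together with its derivatives. *)
pose K' := (fun z : 'rV[R]_n * M => act (cinv c z.1)^-1%g z.2) @` (Q2 `*` K).
have cK' : compact K'.
  apply: continuous_compact; last exact: compact_setX.
  apply: continuous_in_subspaceT => z; rewrite inE => -[Qz _].
  apply: (@continuous_comp _ _ _ (fun z : 'rV[R]_n * M => ((cinv c z.1)^-1%g, z.2))
    (fun z : G * M => act z.1 z.2)); last exact: cact.
  apply: pair_continuous; last exact: cvg_snd.
  apply: (@continuous_comp _ _ _ (fun z : 'rV[R]_n * M => cinv c z.1) (fun g : G => g^-1%g)).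
    apply: (@continuous_comp _ _ _ fst (cinv c)); first exact: cvg_fst.
    by have [_ _ _ _] := hG.1 _ Ac; apply; exact: QW.
  by have [_ _ [+ _]] := G_lie; apply.
have Q2W u : Q u -> W u.
  by move=> Qu; apply: QW => /=; apply: le_trans Qu _; lra.
have [L L0 LDD] : exists2 L : R, 0 < L & forall j z, (Q `*` K') z -> `|DD j z| <= L.
  apply: finite_bound => j; apply: compact_bound; first exact: compact_setX.
  by move=> z [/Q2W Wz _]; exact: cDD.
exists L => // j x u Qu.
have [Kx|nKx] := pselect (K' x); first by have := LDD j (u, x); apply.
have F0 v : Q2 v -> F x v = 0.
  move=> Qv; apply: contrapT => /eqP Fx; apply: nKx.
  exists (v, act (cinv c v) x); last by rewrite /= -actM mulgV act1.
  by split => //; exact: subset_closure.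
have nQ v : `|v - u1| < 2 * r -> \forall w \near v, `|w - u1| < 2 * r.
  move=> vr; near=> w; apply: (@le_lt_trans _ _ (`|w - v| + `|v - u1|)).
    by rewrite -[w - u1](subrKA v) ler_normD.
  rewrite -ltrBrDr; near: w.
  have e0 : 0 < 2 * r - `|v - u1| by rewrite subr_gt0.
  by apply/nbhs_ballP; exists (2 * r - `|v - u1|) => //= w; rewrite -ball_normE /= distrC.
have D0 (f : 'rV[R]_n -> R) : (forall v, `|v - u1| < 2 * r -> f v = 0) ->
    forall v, `|v - u1| < 2 * r -> 'D_(delta_mx 0 j) f v = 0.
  move=> f0 v vr; rewrite (@near_eq_derive _ _ _ f (cst 0)) ?derive_cst //.
  by apply: filterS (nQ v vr) => w; exact: f0.
have ur : `|u - u1| < 2 * r by apply: le_lt_trans Qu _; lra.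
rewrite (D0 _ (D0 _ _)) ?normr0 ?(ltW L0) // => v vr.
by apply: F0; exact: ltW.
Unshelve. all: by end_near. Qed.

End OrbitMaps.

Section BoundedCutoffs.
Context {R : realType} (G : ptopologicalGroupType) (n : nat) (AG : set (chart R G n)).
Hypothesis G_lie : lie_group AG.
Context (M : ptopologicalType) (m : nat) (AM : set (chart R M m)).
Hypothesis mM : is_manifold AM.
Variable act : G -> M -> M.
Hypothesis act_smooth : smooth_right_action AG AM act.
Variables (d : nat) (Z : 'I_d -> (G -> R) -> G -> R) (expZ : 'I_d -> R -> G).
Hypothesis expZ_exp : forall i, exponential_curve AG (Z i) (expZ i).

Let mG : is_manifold AG.
Proof. by have [] := G_lie. Qed.

Let hG : charted AG := manifold_charted mG.
Let V i := fundamental_field act (expZ i).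

Lemma fundamental_fieldE i f x df :
  is_derive (0 : R) (1 : R) (fun s : R => f (act (expZ i s) x)) df -> V i f x = df.
Proof. by move=> [_ <-]; rewrite /V /fundamental_field derive1E. Qed.

(* A smooth [psi] is averaged over the translates by a grid of [N ^ n] group
   elements in a cube of the chart [c]. As the derivative of an average along
   [V i] falls on the grid variables, a summation by parts along the grid lines
   bounds it in terms of [sup psi] alone. *)
Lemma averaged_cutoff : exists C : R, 0 <= C /\
  exists c (u1 : 'rV[R]_n) (r : R), [/\ AG c,
    [set u | `|u - u1| <= r] `<=` cimage c setT &
    forall psi : M -> R, test_function AM psi -> (forall y, 0 <= psi y <= 1) ->
    exists chi : M -> R, [/\ test_function AM chi, (forall x, 0 <= chi x <= 1),
      (forall i x, derivable (fun s : R => chi (act (expZ i s) x)) 0 1),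
      (forall i x, `|V i chi x| <= C) &
      forall x, (forall u, `|u - u1| <= r -> \forall v \near u, psi (act (cinv c v) x) = 1) ->
        chi x = 1 /\ forall i, V i chi x = 0]].
Proof.
have [act1 actM _] := act_smooth.
have [c Ac c1] := hG.2 1%g; pose W := cimage c setT.
have cc := hG.1 _ Ac; have [od oi cK cm ci] := cc.
have [r [r0 QW2 _ _]] := chart_bump mG Ac c1; set u1 := cmap c 1%g in QW2.
pose Q := [set u : 'rV[R]_n | `|u - u1| <= r].
have QW : Q `<=` W by move=> u Qu; apply: QW2 => /=; apply: le_trans Qu _; lra.
have cQ : compact Q by apply: cube_compact; exact: ltW.
have [b Hb] := choice (fun i => exponential_curve_field G_lie mM act_smooth (expZ_exp i) Ac c1).
have sb i j : smooth_on W (b i j) by have [] := Hb i.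
have [B B0 [bB dbB]] : exists2 B : R, 0 < B &
    (forall i j u, Q u -> `|b i j u| <= B) /\
    (forall i j u, Q u -> `|'D_(delta_mx 0 j) (b i j) u| <= B).
  have [B1 B10 HB1] : exists2 B : R, 0 < B & forall (p : 'I_d * 'I_n) u, Q u -> `|b p.1 p.2 u| <= B.
    apply: finite_bound => p; apply: compact_bound cQ _ => u /QW Wu.
    by have [+ _] := sb p.1 p.2 0%N; exact.
  have [B2 B20 HB2] : exists2 B : R, 0 < B & forall (p : 'I_d * 'I_n) u, Q u ->
      `|'D_(delta_mx 0 p.2) (b p.1 p.2) u| <= B.
    apply: finite_bound => p; apply: compact_bound cQ _ => u /QW Wu.
    by have [_ /(_ p.2)[_ [+ _]]] := sb p.1 p.2 1%N; exact.
  exists (B1 + B2); first exact: addr_gt0.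
  split=> i j u Qu.
    by apply: le_trans (HB1 (i, j) u Qu) _; rewrite lerDl ltW.
  by apply: le_trans (HB2 (i, j) u Qu) _; rewrite lerDr ltW.
(* The grid lies in a cube of side [rho] with corner [u1]; the other half of [r] leaves room for
   shifts of length up to [rho] inside [Q]. *)
pose rho := r / 2; have rho0 : 0 < rho by rewrite divr_gt0.
(* In the summation by parts along lines of length [rho], [2 * B] comes from the endpoints and
   [B * rho] from the variation of the coefficients; the final [1] pays for the discretisation.
   Nothing here involves [psi]. *)
pose E := (2 * B + B * rho) / rho + 1.
have E0 : 0 <= E.
  by rewrite /E addr_ge0 // divr_ge0 ?(ltW rho0) // addr_ge0 // mulr_ge0 // ltW.
exists (n%:R * E); split; first by rewrite mulr_ge0.
exists c, u1, r; split => // psi tpsi psi01.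
have spsi : smooth_fun AM psi by case: tpsi.
have [L L0 LDD] := second_derivative_bound G_lie mM act_smooth Ac r0 QW2 tpsi.
(* With [h = rho / N] this gives [B * h * L <= 1]. As [L] depends on [psi], so does the grid, but
   not the bound [E]. *)
pose N := (Num.truncn (B * rho * L)).+1.
have NB : B * rho * L <= N%:R by apply/ltW; exact: truncnS_gt.
have N0 : 0 < N%:R :> R by rewrite ltr0n.
pose h := rho / N%:R; have h0 : 0 < h by rewrite divr_gt0.
have hrho : h <= rho by rewrite ler_pdivrMr // ler_peMr ?(ltW rho0) // ler1n.
have hN : h * N%:R = rho by rewrite divfK // gt_eqF.
pose pt (l : 'I_n -> nat) : 'rV[R]_n := \row_j (u1 0 j + h * (l j)%:R).
have ptQ l : (forall j, (l j <= N)%N) -> `|pt l - u1| <= rho.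
  move=> lN; apply/rV_norm_le => [|j]; first exact: ltW.
  rewrite !mxE addrAC subrr add0r ger0_norm; last exact: mulr_ge0 (ltW h0) (ler0n R _).
  by rewrite -hN ler_pM2l // ler_nat.
have e_le (j : 'I_n) (t : R) : `|t *: (delta_mx 0 j : 'rV[R]_n)| <= `|t|.
  apply/rV_norm_le => // i; rewrite !mxE.
  by case: (_ && _); rewrite ?mulr1 // mulr0 normr0.
have shiftQ w j (t : R) : `|w - u1| <= rho -> `|t| <= h -> Q (w + t *: delta_mx 0 j).
  move=> wr th; rewrite /Q /= addrAC; apply: le_trans (ler_normD _ _) _.
  have -> : r = rho + rho by rewrite /rho; lra.
  by apply: lerD => //; apply: le_trans (e_le _ _) _; exact: le_trans th _.
pose F x u := psi (act (cinv c u) x).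
have sF x : smooth_on W (F x) by exact: (orbit_smooth G_lie mM act_smooth).
have F1 x u : `|F x u| <= 1 by have /andP[f0 f1] := psi01 (act (cinv c u) x); rewrite ger0_norm.
have dF x j u : Q u -> derivable (F x) u (delta_mx 0 j).
  by move=> /QW; have [_ /(_ j)[+ _]] := sF x 1%N; exact.
have dDF x j u : Q u -> derivable ('D_(delta_mx 0 j) (F x)) u (delta_mx 0 j).
  by move=> /QW; have [_ /(_ j)[_ [_ /(_ j)[+ _]]]] := sF x 2%N; exact.
have db i j u : Q u -> derivable (b i j) u (delta_mx 0 j).
  by move=> /QW; have [_ /(_ j)[+ _]] := sb i j 1%N; exact.
have hnorm : `|h| = h by rewrite gtr0_norm.
have hle : `|h| <= h by rewrite hnorm.
(* The mean value theorem is used twice: the quotient is a derivative at some point of the segment,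
   and returning to [w] costs at most [h] times the bound on second derivatives. *)
have quotient_err x j w : `|w - u1| <= rho ->
    `|'D_(delta_mx 0 j) (F x) w - (F x (w + h *: delta_mx 0 j) - F x w) / h| <= h * L.
  move=> wr.
  have [t th ->] := MVT_line (s := h) (fun t th => shiftQ w j t wr (le_trans th hle))
    (fun u => dF x j u).
  rewrite mulfK ?gt_eqF // distrC.
  have [t' t't ->] := MVT_line (s := t)
    (fun t' t't => shiftQ w j t' wr (le_trans t't (le_trans th hle)))
    (fun u => dDF x j u).
  rewrite normrM mulrC; apply: ler_pM => //; first by rewrite -hnorm.
  by apply: LDD; apply: shiftQ => //; rewrite -hnorm; exact: le_trans th.
pose pk (k : {ffun 'I_n -> 'I_N}) := pt (fun j => k j).
have pkr k : `|pk k - u1| <= rho by apply: ptQ => j; exact: ltnW (ltn_ord _).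
pose chi x : R := (N ^ n)%:R^-1 * \sum_(k : {ffun 'I_n -> 'I_N}) psi (act (cinv c (pk k)) x).
have Nn0 : 0 < (N ^ n)%:R :> R by rewrite ltr0n expn_gt0.
have ptW (k : {ffun 'I_n -> 'I_N}) : W (pk k).
  by apply: QW => /=; apply: le_trans (pkr k) _; rewrite /rho; lra.
have dchi i x : is_derive (0 : R) (1 : R) (fun s : R => chi (act (expZ i s) x))
    ((N ^ n)%:R^-1 * \sum_(k : {ffun 'I_n -> 'I_N}) \sum_j
      b i j (pk k) * 'D_(delta_mx 0 j) (F x) (pk k)).
  have [_ /(_ psi spsi x)Hi] := Hb i.
  have := is_derive_big (index_enum _) (fun k : {ffun 'I_n -> 'I_N} => Hi (pk k) (ptW k)).
  by move=> /(is_deriveZ (N ^ n)%:R^-1).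
have Vchi i x := fundamental_fieldE (dchi i x).
exists chi; split.
- apply: (test_functionZ mM); apply: (test_function_sum mM) => k.
  exact: (test_function_act G_lie mM act_smooth).
- move=> x; rewrite mulr_ge0 ?invr_ge0 ?(ltW Nn0) //=; last first.
    by apply: sumr_ge0 => k _; have /andP[] := psi01 (act (cinv c (pk k)) x).
  rewrite ler_pdivrMl // mulr1.
  have -> : (N ^ n)%:R = \sum_(k : {ffun 'I_n -> 'I_N}) (1 : R).
    by rewrite sumr_const card_ffun !card_ord.
  by apply: ler_sum => k _; have /andP[] := psi01 (act (cinv c (pk k)) x).
- by move=> i x; have [] := dchi i x.
- move=> i x; rewrite Vchi normrM normfV (gtr0_norm Nn0) ler_pdivrMl //.
  rewrite exchange_big /=; apply: le_trans (ler_norm_sum _ _ _) _.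
  rewrite mulrCA mulr_natl -[n in _ *+ n]card_ord -sumr_const; apply: ler_sum => j _.
  apply: (sum_lines_le (j := j)) => // k.
  pose pl (l : nat) := pt (fun i => if i == j then l else k i).
  have set_coordE l : pk (set_coord k j l) = pl l.
    by apply/rowP => i'; rewrite !mxE ffunE; case: eqP.
  have plS l : pl l.+1 = pl l + h *: delta_mx 0 j.
    apply/rowP => i'; rewrite !mxE; case: eqP => _ /=.
      by rewrite mulr1 -natr1 mulrDr mulr1 addrA.
    by rewrite mulr0 addr0.
  have plr l : (l <= N)%N -> `|pl l - u1| <= rho.
    by move=> lN; apply: ptQ => i'; case: eqP => // _; exact: ltnW (ltn_ord _).
  have plQ l : (l <= N)%N -> Q (pl l).
    by move=> /plr lr; rewrite /Q /=; apply: le_trans lr _; rewrite /rho; lra.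
  under eq_bigr do rewrite set_coordE.
  (* On a grid line, derivatives are replaced by difference quotients, to which [abel_bound]
     applies, plus an error of at most 1 per point. *)
  have -> : \sum_(l < N) b i j (pl l) * 'D_(delta_mx 0 j) (F x) (pl l) =
      (\sum_(l < N) b i j (pl l) * (F x (pl l.+1) - F x (pl l))) / h +
      \sum_(l < N) b i j (pl l) *
        ('D_(delta_mx 0 j) (F x) (pl l) - (F x (pl l.+1) - F x (pl l)) / h).
    rewrite mulr_suml -big_split /=; apply: eq_bigr => l _.
    by rewrite -mulrA -mulrDr [X in _ = _ * X]addrC subrK.
  apply: le_trans (ler_normD _ _) _.
  have -> : N%:R * E = (2 * B + N%:R * (B * h)) / h + N%:R.
    rewrite /E mulrDr mulr1; congr (_ + _).
    have -> : N%:R * (B * h) = B * rho by rewrite mulrCA [N%:R * h]mulrC hN.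
    by rewrite mulrC -mulrA -[rho^-1 * _]invrK invfM invrK.
  apply: lerD.
    rewrite normrM normfV hnorm ler_pM2r ?invr_gt0 //.
    apply: (@abel_bound _ N (fun l => b i j (pl l)) (fun l => F x (pl l))) => l lN.
    - by apply: bB; exact: plQ.
    - exact: F1.
    - rewrite plS.
      have [t th ->] := MVT_line (s := h)
        (fun t th => shiftQ (pl l) j t (plr l (ltnW lN)) (le_trans th hle))
        (fun u => db i j u).
      rewrite normrM hnorm ler_pM2r //; apply: dbB; apply: shiftQ; first exact/plr/ltnW.
      by rewrite -hnorm.
  apply: le_trans (ler_norm_sum _ _ _) _.
  have -> : N%:R = \sum_(l < N) (1 : R) by rewrite sumr_const card_ord.
  apply: ler_sum => l _; rewrite normrM plS.
  have lN : (l <= N)%N by exact: ltnW.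
  apply: (@le_trans _ _ (B * (h * L))).
    by apply: ler_pM => //; [exact/bB/plQ|exact/quotient_err/plr].
  by rewrite /h mulrA mulrA mulrAC ler_pdivrMr // mul1r.
- move=> x xu; have ptr (k : {ffun 'I_n -> 'I_N}) : `|pk k - u1| <= r.
    by apply: le_trans (pkr k) _; rewrite /rho; lra.
  split.
    rewrite /chi (eq_bigr (fun=> 1)) => [|k _]; last exact: nbhs_singleton (xu _ (ptr k)).
    by rewrite sumr_const card_ffun !card_ord mulVf // gt_eqF.
  move=> i; rewrite Vchi big1 ?mulr0 // => k _; rewrite big1 // => j _.
  rewrite (@near_eq_derive _ _ _ (F x) (cst 1)) ?derive_cst ?mulr0 //.
  exact: xu.
Qed.

(** For fixed [x] the average involves [psi k] only near the image of the compact cube under the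
    orbit map. By the locally uniform clause of [cutoffs] and compactness, one rank works for the
    whole cube. *)
Lemma bounded_cutoffs : exists C : R, 0 <= C /\ exists chi : nat -> M -> R,
  [/\ (forall k, test_function AM (chi k)), (forall k x, 0 <= chi k x <= 1),
      (forall k i x, derivable (fun s : R => chi k (act (expZ i s) x)) 0 1),
      (forall k i x, `|V i (chi k) x| <= C) &
      forall x, \forall k \near \oo, chi k x = 1 /\ forall i, V i (chi k) x = 0].
Proof.
have [C [C0 [c [u1 [r [Ac QW avg]]]]]] := averaged_cutoff.
have [psi [tpsi psi01 psi1]] := cutoffs mM.
have [chi Hchi] := choice (fun k => avg (psi k) (tpsi k) (psi01 k)).
exists C; split => //; exists chi; split.
- by move=> k; have [] := Hchi k.
- by move=> k; have [] := Hchi k.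
- by move=> k; have [] := Hchi k.
- by move=> k; have [] := Hchi k.
move=> x.
(* [averaged_cutoff] does not record the sign of [r]; for [r < 0] the cube is empty and its last
   clause applies for every [k]. *)
have [r0|r0] := leP 0 r; last first.
  apply: nearW => k; have [_ _ _ _] := Hchi k; apply => u ur; exfalso.
  by have := le_lt_trans ur r0; rewrite normr_lt0.
have /compact_near_coveringP cov : compact [set u : 'rV[R]_n | `|u - u1| <= r]
  by exact: cube_compact.
pose Q := [set u : 'rV[R]_n | `|u - u1| <= r].
have oc u : Q u -> {for u, continuous (fun v => act (cinv c v) x)}.
  by move=> Qu; apply: (orbit_continuous G_lie mM act_smooth) => //; exact: QW.
pose P (k : nat) (u : 'rV[R]_n) := \forall v \near u, psi k (act (cinv c v) x) = 1.
suff : \forall k \near \oo, Q `<=` P k by apply: filterS => k QP; have [_ _ _ _] := Hchi k; apply.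
apply: (cov _ _ P) => u Qu.
have [[U K] /= [nU nK] UK] := psi1 (act (cinv c u) x).
exists ((fun v => act (cinv c v) x) @^-1` U `&` cimage c setT, K).
  split => //=; apply: filterI; first exact: oc nU.
  by apply: near_open; [have [] := hG.1 _ Ac|exact: QW].
move=> [v k] [/= [Uv Wv] Kk].
have := UK (act (cinv c v) x, k) (conj Uv Kk).
by apply: (orbit_continuous G_lie mM act_smooth Ac).
Qed.

End BoundedCutoffs.

(** * Integration and perturbation *)

Section Density.
Context {R : realType}.

Lemma continuous_borel_measurable (M : ptopologicalType) (f : M -> R) :
  continuous f -> measurable_fun setT (f : borel M -> R).
Proof.
move=> /continuousP cf; apply: (measurability _ (RGenOpens.measurableE R)).
move=> _ [_ [a [b ->] <-]]; rewrite setTI; apply: sub_sigma_algebra.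
exact/cf/interval_open.
Qed.

Import HBNNSimple.

(** The identity on sets extends to simple functions by linearity, then to [f] by monotone
    convergence along the increasing approximation [h]. *)
Lemma integral_density d (T : measurableType d) (mu nu : {measure set T -> \bar R})
    (p f : T -> R) : measurable_fun setT p -> (forall x, 0 <= p x) ->
  (forall S, measurable S -> nu S = (\int[mu]_(x in S) (p x)%:E)%E) ->
  measurable_fun setT f -> (forall x, 0 <= f x) ->
  (\int[nu]_x (f x)%:E = \int[mu]_x (f x * p x)%:E)%E.
Proof.
move=> mp p0 nup mf f0.
have simple (h : {nnsfun T >-> R}) : (\int[nu]_x (h x)%:E = \int[mu]_x (h x * p x)%:E)%E.
  have mA y : measurable (h @^-1` [set y]) by [].
  have mAp y : measurable_fun setT (EFin \o (fun x => \1_(h @^-1` [set y]) x * p x : R)).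
    by apply/measurable_EFinP; apply: measurable_funM => //; exact: measurable_indic.
  have Ap0 y x : (0 <= (\1_(h @^-1` [set y]) x * p x)%:E)%E.
    by rewrite lee_fin mulr_ge0.
  rewrite integralT_nnsfun sintegralE.
  transitivity (\int[mu]_x \sum_(y \in range h) (y * (\1_(h @^-1` [set y]) x * p x))%:E)%E.
    rewrite ge0_integral_fsum //; last 2 first.
    - by move=> y; apply/measurable_EFinP; apply: measurable_funM => //; exact/measurable_EFinP.
    - move=> y x _; have [y0|y0] := leP 0 y; first by rewrite lee_fin mulr_ge0 // -lee_fin.
      by rewrite preimage_nnfun0 // indic0 mul0r mulr0.
    apply: eq_fsbigr => y; rewrite inE => -[x _ hx].
    have y0 : 0 <= y by rewrite -hx.
    under eq_integral do rewrite EFinM.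
    rewrite ge0_integralZl ?lee_fin //; last exact: mAp.
    congr (_ * _)%E; apply: etrans (nup _ (mA y)) _.
    rewrite [LHS]integral_mkcond; apply: eq_integral => z _.
    by rewrite patchE indicE; case: ifP => _; rewrite ?mul1r ?mul0r.
  apply: eq_integral => x _; rewrite (fimfunE h x) fsumEFin //; congr EFin.
  by rewrite mulr_fsuml; apply: eq_fsbigr => y _; rewrite mulrA.
have mEf : measurable_fun setT (EFin \o f) by exact/measurable_EFinP.
pose h := nnsfun_approx measurableT mEf.
have hf x : (EFin \o (fun k => h k x)) @ \oo --> (f x)%:E.
  by apply: cvg_nnsfun_approx => // y _; rewrite lee_fin.
have hnd x : {homo (fun k => h k x) : i j / (i <= j)%N >-> i <= j}.
  by move=> i j ij; exact/lefP/nd_nnsfun_approx.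
have fE : (fun x => (f x)%:E) = (fun x => limn (fun k => (h k x)%:E)).
  by apply/funext => x; apply/esym/cvg_lim => //; exact: hf.
have fpE : (fun x => (f x * p x)%:E) = (fun x => limn (fun k => (h k x * p x)%:E)).
  apply/funext => x; apply/esym/cvg_lim => //.
  by under eq_fun do rewrite EFinM; rewrite EFinM; apply: cvgeZr => //; exact: hf.
rewrite fE fpE !monotone_convergence //.
- by congr (limn _); apply/funext => k; exact: simple.
- by move=> k; apply/measurable_EFinP; exact: measurable_funM.
- by move=> k x _; rewrite lee_fin mulr_ge0.
- by move=> x _ i j ij; rewrite lee_fin ler_wpM2r //; exact: hnd.
- by move=> k; exact/measurable_EFinP.
- by move=> k x _; rewrite lee_fin.
- by move=> x _ i j ij; rewrite lee_fin; exact: hnd.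
Qed.

End Density.

(** * Extension of the Poincare inequality to all test functions, and change of weight *)

Section PoincarePerturbation.
Context {R : realType}.

Lemma sqrB_le2 (x y s t : R) : x ^+ 2 <= s -> y ^+ 2 <= t -> (x - y) ^+ 2 <= 2 * s + 2 * t.
Proof. have := sqr_ge0 (x + y); rewrite !expr2; nra. Qed.

Lemma bounded_integrable d (T : measurableType d) (P : probability T R) (f : T -> R) (B : R) :
  measurable_fun setT f -> (forall x, `|f x| <= B) -> P.-integrable setT (EFin \o f).
Proof.
move=> mf fB.
apply: (le_integrable measurableT _ _ (finite_measure_integrable_cst P B measurableT)).
  exact/measurable_EFinP.
by move=> x _ /=; rewrite lee_fin (le_trans (fB x)) // ler_norm.
Qed.

(* [al_k f - A chi_k], with [al_k] and [A] the means of [chi_k] and [f], has mean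
   zero and tends to [f - A]; this extends the Poincare inequality from
   mean-zero test functions to all test functions. *)
Lemma poincare_mean d (T : measurableType d) (P : probability T R) (I : finType)
    (f : T -> R) (B C a : R) (chi : nat -> T -> R) (df : I -> T -> R)
    (dchi : nat -> I -> T -> R) :
  measurable_fun setT f -> (forall x, `|f x| <= B) ->
  (forall k, measurable_fun setT (chi k)) -> (forall k x, 0 <= chi k x <= 1) ->
  (forall i, measurable_fun setT (df i)) -> (forall k i, measurable_fun setT (dchi k i)) ->
  (forall k i x, `|dchi k i x| <= C) ->
  (forall x, \forall k \near \oo, chi k x = 1 /\ forall i, dchi k i x = 0) ->
  let A := fine (\int[P]_x (f x)%:E) in
  (forall k, let al := fine (\int[P]_x (chi k x)%:E) in
    (a%:E * \int[P]_x ((al * f x - A * chi k x) ^+ 2)%:E <=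
     \int[P]_x (\sum_i (al * df i x - A * dchi k i x) ^+ 2)%:E)%E) ->
  (a%:E * \int[P]_x ((f x - A) ^+ 2)%:E <= \int[P]_x (\sum_i df i x ^+ 2)%:E)%E.
Proof.
move=> mf fB mchi chi01 mdf mdchi dchiC chi1 A H.
have chi_le1 k x : `|chi k x| <= 1 by have /andP[c0 c1] := chi01 k x; rewrite ger0_norm.
have ichi k := bounded_integrable P (mchi k) (chi_le1 k).
pose al k := fine (\int[P]_x (chi k x)%:E).
have alE k : (\int[P]_x (chi k x)%:E = (al k)%:E)%E.
  by rewrite fineK //; exact: integrable_fin_num (ichi k).
have al01 k : 0 <= al k <= 1.
  rewrite -!lee_fin -alE; apply/andP; split.
    by apply: integral_ge0 => x _; rewrite lee_fin; have /andP[] := chi01 k x.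
  rewrite -[leRHS](probability_setT P) -[leRHS]mul1e -integral_cst //.
  apply: ge0_le_integral => //.
  - by move=> x _; rewrite lee_fin; have /andP[] := chi01 k x.
  - exact/measurable_EFinP.
  - by move=> x _; rewrite lee_fin; have /andP[] := chi01 k x.
have al1 : al @ \oo --> (1 : R).
  have [||||| _ _ cv] := @dominated_convergence _ _ _ P setT measurableT
    (fun k x => (chi k x)%:E) (cst 1%E) (cst 1%E).
  - by move=> k; exact/measurable_EFinP.
  - exact: measurable_cst.
  - apply: aeW => x _; apply: cvg_near_cst.
    by apply: filterS (chi1 x) => k [-> _].
  - exact: (finite_measure_integrable_cst P 1).
  - by apply: aeW => x k _; rewrite /= lee_fin.
  move: cv; rewrite integral_cst // mul1e [X in _ --> X](@probability_setT _ _ _ P).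
  by move=> /fine_cvg.
have B0 (x : T) : 0 <= B by apply: le_trans (fB x).
have sum_sq_ge0 (u : I -> R) : 0 <= \sum_i u i ^+ 2 by apply: sumr_ge0 => i _; exact: sqr_ge0.
pose u k x := (al k * f x - A * chi k x) ^+ 2.
pose g k x := \sum_i (al k * df i x - A * dchi k i x) ^+ 2.
have mlin (b c : R) (h h' : T -> R) : measurable_fun setT h -> measurable_fun setT h' ->
    measurable_fun setT (fun x => (b * h x - c * h' x) ^+ 2).
  move=> mh mh'; apply: measurable_funX; apply: measurable_funB.
    exact: measurable_funM.
  exact: measurable_funM.
have cu x : u ^~ x @ \oo --> (f x - A) ^+ 2.
  have c1 : al k * f x @[k --> \oo] --> f x.
    by rewrite -[X in _ --> X]mul1r; apply: cvgM al1 _; exact: cvg_cst.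
  have c2 : A * chi k x @[k --> \oo] --> A.
    by apply: cvg_near_cst; apply: filterS (chi1 x) => k [-> _]; rewrite mulr1.
  by rewrite expr2; under eq_fun do rewrite /u expr2; apply: cvgM; exact: cvgB.
have cg x : g ^~ x @ \oo --> \sum_i df i x ^+ 2.
  have ca : \sum_i (al k * df i x) ^+ 2 @[k --> \oo] --> \sum_i df i x ^+ 2.
    have -> : (fun k => \sum_i (al k * df i x) ^+ 2) =
        (fun k => al k * al k * \sum_i df i x ^+ 2).
      by apply/funext => k; rewrite mulr_sumr; apply: eq_bigr => i _; ring.
    have : al k * al k * \sum_i df i x ^+ 2 @[k --> \oo] --> 1 * 1 * \sum_i df i x ^+ 2.
      by apply: cvgM; [exact: cvgM|exact: cvg_cst].
    by rewrite !mul1r.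
  apply: cvg_trans ca; apply: near_eq_cvg.
  apply: filterS (chi1 x) => k [_ d0]; rewrite /g.
  by apply: eq_bigr => i _; rewrite d0 mulr0 subr0.
have EFin_cvg (v : nat -> R) (l : R) : v @ \oo --> l -> (fun k => (v k)%:E) @ \oo --> l%:E.
  by move=> vl; apply: cvg_EFin; [exact: nearW|exact: vl].
have [||||| _ _ c1] := @dominated_convergence _ _ _ P setT measurableT
    (fun k x => (u k x)%:E) (fun x => ((f x - A) ^+ 2)%:E) (cst ((B + `|A|) ^+ 2)%:E).
- by move=> k; apply/measurable_EFinP; exact: mlin.
- by apply/measurable_EFinP; apply: measurable_funX; exact: measurable_funB.
- by apply: aeW => x _; apply: EFin_cvg; exact: cu.
- exact: (finite_measure_integrable_cst P _).
- apply: aeW => x k _; rewrite /= lee_fin ger0_norm ?sqr_ge0 // /u.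
  rewrite -[leLHS]real_normK ?num_real // ler_pXn2r ?nnegrE //; last first.
    by rewrite addr_ge0 // (B0 x).
  apply: le_trans (ler_normB _ _) _; rewrite !normrM; have /andP[l0 l1] := al01 k.
  rewrite (ger0_norm l0); apply: lerD; last exact: ler_piMr.
  by apply: le_trans (fB x); exact: ler_piMl.
(* If the right-hand side is infinite there is nothing to prove; otherwise the energy density of [f]
   is integrable and can dominate the approximating energies. *)
have [->|Goo] := eqVneq (\int[P]_x (\sum_i df i x ^+ 2)%:E)%E +oo%E; first exact: leey.
have mG : measurable_fun setT (fun x => \sum_i df i x ^+ 2).
  by apply: measurable_sum => i; exact: measurable_funX.
have iG : P.-integrable setT (EFin \o (fun x => \sum_i df i x ^+ 2)).
  apply/integrableP; split; first exact/measurable_EFinP.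
  rewrite (eq_integral (fun x => (\sum_i df i x ^+ 2)%:E)) ?ltey // => x _ /=.
  by rewrite ger0_norm.
(* The domination is [(x - y)^2 <= 2 x^2 + 2 y^2] with [al k] in [[0, 1]]; [K] collects the bounded
   contribution of the cutoff derivatives. *)
pose K := \sum_(i : I) 2 * (`|A| * C) ^+ 2.
have iGK : P.-integrable setT (fun x => 2%:E * (\sum_i df i x ^+ 2)%:E + K%:E)%E.
  apply: integrableD => //; first exact: integrableZl.
  exact: (finite_measure_integrable_cst P K).
have [|||| _ _ c2] := @dominated_convergence _ _ _ P setT measurableT
    (fun k x => (g k x)%:E) (fun x => (\sum_i df i x ^+ 2)%:E) _ _ _ _ iGK.
- by move=> k; apply/measurable_EFinP; apply: measurable_sum => i; exact: mlin.
- exact/measurable_EFinP.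
- by apply: aeW => x _; apply: EFin_cvg; exact: cg.
- apply: aeW => x k _; rewrite /= -EFinM -EFinD lee_fin ger0_norm; last exact: sum_sq_ge0.
  rewrite mulr_sumr -big_split /=; apply: ler_sum => i _.
  have /andP[l0 l1] := al01 k.
  have h1 : (al k * df i x) ^+ 2 <= df i x ^+ 2.
    by rewrite exprMn ler_piMl ?sqr_ge0 // expr_le1.
  have h2 : (A * dchi k i x) ^+ 2 <= (`|A| * C) ^+ 2.
    rewrite -[leLHS]real_normK ?num_real // normrM ler_pXn2r ?nnegrE ?mulr_ge0 //.
      by rewrite ler_wpM2l.
    exact: le_trans (dchiC k i x).
  exact: sqrB_le2 h1 h2.
have c1' := cvgeZl (erefl : a%:E \is a fin_num) c1.
have := lee_lim (cvgP _ c1') (cvgP _ c2) (nearW _ H).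
rewrite (cvg_lim (@ereal_hausdorff R) c1') (cvg_lim (@ereal_hausdorff R) c2); exact.
Qed.

Lemma integrable_bounded_mul d (T : measurableType d) (mu : {measure set T -> \bar R})
    (f w : T -> R) (B : R) :
  measurable_fun setT f -> (forall x, `|f x| <= B) -> (forall x, 0 <= w x) ->
  mu.-integrable setT (EFin \o w) -> mu.-integrable setT (fun x => (f x * w x)%:E).
Proof.
move=> mf fB w0 iw; have mw : measurable_fun setT w.
  by apply/measurable_EFinP; exact: measurable_int iw.
have iBw : mu.-integrable setT (fun x => B%:E * (w x)%:E)%E by exact: integrableZl.
apply: le_integrable iBw => //; first by apply/measurable_EFinP; exact: measurable_funM.
move=> x _; rewrite /= lee_fin normrM [leRHS]normrM ler_wpM2r //.
exact: le_trans (fB x) (ler_norm _).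
Qed.

(* Holley-Stroock: [A] need not be the mean of [f] for [w], since
   [\int f^2 w <= \int (f - A)^2 w] for every [A] when [\int f w = 0]. *)
Lemma poincare_perturbation d (T : measurableType d) (mu : {measure set T -> \bar R})
    (p w f Gam : T -> R) (D a A B : R) :
  measurable_fun setT p -> measurable_fun setT f -> measurable_fun setT Gam ->
  (forall x, 0 <= p x) -> (forall x, 0 <= w x) ->
  (forall x, 0 <= Gam x) -> (forall x, `|f x| <= B) ->
  (forall x, w x <= expR D * p x) -> (forall x, p x <= expR D * w x) ->
  mu.-integrable setT (EFin \o w) -> 0 < a ->
  (a%:E * \int[mu]_x ((f x - A) ^+ 2 * p x)%:E <= \int[mu]_x (Gam x * p x)%:E)%E ->
  (\int[mu]_x (f x * w x)%:E = 0)%E ->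
  (\int[mu]_x (f x ^+ 2 * w x)%:E <=
   (expR (2 * D) / a)%:E * \int[mu]_x (Gam x * w x)%:E)%E.
Proof.
move=> mp mf mG p0 w0 G0 fB wp pw iw a0 poin fw0.
have mw : measurable_fun setT w by apply/measurable_EFinP; exact: measurable_int iw.
have mf2 (b : R) : measurable_fun setT (fun x => (f x - b) ^+ 2).
  by apply: measurable_funX; exact: measurable_funB.
have eD0 : 0 <= expR D by exact: expR_ge0.
(* Adding [2 A f w], of integral zero, to [(f - A)^2 w] gives [f^2 w + A^2 w], which is at least
   [f^2 w]. *)
have step1 : (\int[mu]_x (f x ^+ 2 * w x)%:E <= \int[mu]_x ((f x - A) ^+ 2 * w x)%:E)%E.
  have i1 : mu.-integrable setT (fun x => ((f x - A) ^+ 2 * w x)%:E).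
    apply: (integrable_bounded_mul (B := (B + `|A|) ^+ 2)) => // x.
    rewrite normrX; apply: lerXn2r; rewrite ?nnegrE ?addr_ge0 //; first exact: le_trans (fB x).
    by apply: le_trans (ler_normB _ _) _; exact: lerD.
  have i2 : mu.-integrable setT (fun x => (2 * A)%:E * (f x * w x)%:E)%E.
    by apply: integrableZl => //; exact: integrable_bounded_mul fB w0 iw.
  have -> : (\int[mu]_x ((f x - A) ^+ 2 * w x)%:E =
      \int[mu]_x (((f x - A) ^+ 2 * w x)%:E + (2 * A)%:E * (f x * w x)%:E))%E.
    rewrite integralD // integralZl ?fw0 ?mule0 ?adde0 //.
    exact: integrable_bounded_mul fB w0 iw.
  apply: ge0_le_integral => //.
  - by move=> x _; rewrite lee_fin mulr_ge0 // sqr_ge0.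
  - by apply/measurable_EFinP; apply: measurable_funM => //; exact: measurable_funX.
  - by apply: emeasurable_funD; [exact: measurable_int i1|exact: measurable_int i2].
  - move=> x _; rewrite -EFinM -EFinD lee_fin.
    have -> : (f x - A) ^+ 2 * w x + 2 * A * (f x * w x) = f x ^+ 2 * w x + A ^+ 2 * w x.
      by ring.
    by rewrite lerDl mulr_ge0 // sqr_ge0.
(* Used twice below, from [w] to [p] for the variance and from [p] back to [w] for the energy; each
   use costs one factor [expR D]. *)
have weight (h q q' : T -> R) : measurable_fun setT h -> measurable_fun setT q ->
    measurable_fun setT q' -> (forall x, 0 <= h x) -> (forall x, 0 <= q x) ->
    (forall x, 0 <= q' x) -> (forall x, q x <= expR D * q' x) ->
    (\int[mu]_x (h x * q x)%:E <= (expR D)%:E * \int[mu]_x (h x * q' x)%:E)%E.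
  move=> mh mq mq' h0 q0 q'0 qq'.
  rewrite -ge0_integralZl //; last 2 first.
  - by apply/measurable_EFinP; exact: measurable_funM.
  - by move=> x _; rewrite lee_fin mulr_ge0.
  apply: ge0_le_integral => //.
  - by move=> x _; rewrite lee_fin mulr_ge0.
  - by apply/measurable_EFinP; exact: measurable_funM.
  - apply/measurable_EFinP; apply: measurable_funM => //; exact: measurable_funM.
  - by move=> x _; rewrite -EFinM lee_fin mulrCA ler_wpM2l.
apply: (le_trans step1).
have sq0 x : 0 <= (f x - A) ^+ 2 by exact: sqr_ge0.
apply: (le_trans (weight _ _ _ (mf2 A) mw mp sq0 w0 p0 wp)).
have step2 : (\int[mu]_x ((f x - A) ^+ 2 * p x)%:E <=
    a^-1%:E * \int[mu]_x (Gam x * p x)%:E)%E.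
  by rewrite lee_pdivlMl.
have e0 : (0 <= (expR D)%:E)%E by rewrite lee_fin.
apply: (le_trans (lee_wpmul2l e0 step2)).
have a0' : (0 <= a^-1%:E)%E by rewrite lee_fin invr_ge0 ltW.
apply: (le_trans (lee_wpmul2l e0 (lee_wpmul2l a0' (weight _ _ _ mG mp mw G0 p0 w0 pw)))).
rewrite !muleA -!EFinM mulr_natl mulr2n expRD.
by rewrite [_ * a^-1 * _]mulrAC.
Qed.

End PoincarePerturbation.

(** * Differentiability, measurability and linearity of fundamental fields *)

Section FundamentalFields.
Context {R : realType} (G : ptopologicalGroupType) (n : nat) (AG : set (chart R G n)).
Hypothesis G_lie : lie_group AG.
Context (M : ptopologicalType) (m : nat) (AM : set (chart R M m)).
Hypothesis mM : is_manifold AM.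
Variable act : G -> M -> M.
Hypothesis act_smooth : smooth_right_action AG AM act.
Variables (Z : (G -> R) -> G -> R) (gamma : R -> G).
Hypothesis gamma_exp : exponential_curve AG Z gamma.
Let V := fundamental_field act gamma.

(** [exponential_curve_field] differentiates the flow followed by [cinv c u]; taking for [u] the
    coordinates of the identity removes the second action. *)
Lemma derivable_act f x : smooth_fun AM f -> derivable (fun s : R => f (act (gamma s) x)) 0 1.
Proof.
move=> sf; have [mG _ _] := G_lie; have [act1 _ _] := act_smooth.
have [c Ac c1] := (manifold_charted mG).2 1%g.
have [b [_ /(_ f sf x (cmap c 1%g) (cmap_cimage c1))[+ _]]] :=
  exponential_curve_field G_lie mM act_smooth gamma_exp Ac c1.
have [_ _ cK _ _] := (manifold_charted mG).1 _ Ac.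
by rewrite cK //; under eq_fun do rewrite act1.
Qed.

(** [V f] is the pointwise limit of its difference quotients at the times [1 / k.+1], each of which
    is continuous. *)
Lemma measurable_fundamental_field f : smooth_fun AM f ->
  measurable_fun setT (V f : borel M -> R).
Proof.
move=> sf; have [act1 _ _] := act_smooth.
pose q (k : nat) (x : M) := k.+1%:R * (f (act (gamma k.+1%:R^-1) x) - f x).
have cf := smooth_fun_continuous mM sf.
apply: (@measurable_fun_cvg _ (borel M) R setT q) => [k|x _].
  apply: measurable_funM => //; apply: measurable_funB;
    apply: (@continuous_borel_measurable R M) => //.
  exact: (smooth_fun_continuous mM (smooth_fun_act G_lie mM act_smooth _ sf)).
have := @derivable_act f x sf => /cvg_ex[/= l dl].
have -> : V f x = l by rewrite /V /fundamental_field derive1E; apply: cvg_lim.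
have hk : (fun k : nat => k.+1%:R^-1 : R) @ \oo --> (0 : R)^'.
  move=> U nU; have : \forall k \near \oo, k.+1%:R^-1 != 0 :> R -> U k.+1%:R^-1.
    exact: (@cvg_harmonic R _ nU).
  by apply: filterS => k; apply; rewrite invr_eq0 pnatr_eq0.
have := cvg_comp _ _ hk dl; apply: cvg_trans; apply: near_eq_cvg; apply: nearW => k /=.
have [g0 _] := gamma_exp.
by rewrite /q invrK addr0 [_%:A]mulr1 g0 act1.
Qed.

Lemma fundamental_field_lin (a b : R) f h x : smooth_fun AM f -> smooth_fun AM h ->
  V (fun y => a * f y + b * h y) x = a * V f x + b * V h x.
Proof.
move=> sf sh; rewrite /V /fundamental_field !derive1E.
have df := @derivable_act f x sf; have dh := @derivable_act h x sh.
have -> : (fun s => a * f (act (gamma s) x) + b * h (act (gamma s) x)) =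
    a *: (fun s => f (act (gamma s) x)) + b *: (fun s => h (act (gamma s) x)) by [].
by rewrite deriveD ?deriveZ //; exact: derivableZ.
Qed.

End FundamentalFields.

Lemma test_function_bounded (R : realType) (T : topologicalType) n (A : set (chart R T n)) f :
  is_manifold A -> test_function A f -> exists B, forall x, `|f x| <= B.
Proof.
move=> mA [sf cf]; have cont := smooth_fun_continuous mA sf.
have [B B0 fB] := compact_bound cf (fun x _ => cont x).
exists B => x; have [->|fx] := eqVneq (f x) 0; first by rewrite normr0 ltW.
by apply: fB; exact: subset_closure.
Qed.

Theorem theorem5p1 (R : realType)
    (* the connected Lie group *)
    (G : ptopologicalGroupType) (n : nat) (AG : set (chart R G n))
    (G_lie : lie_group AG) (G_connected : connected [set: G])
    (* the homogeneous space *)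
    (M : ptopologicalType) (m : nat) (AM : set (chart R M m))
    (M_manifold : is_manifold AM)
    (act : G -> M -> M) (act_smooth : smooth_right_action AG AM act)
    (act_trans : transitive_action act) (o : M)
    (mu : {measure set (borel M) -> \bar R})
    (mu_inv : invariant_measure act mu)
    (* the vector fields *)
    (d : nat) (Z : 'I_d -> (G -> R) -> G -> R)
    (Z_left : forall i, left_invariant AG (Z i))
    (Z_gen : generates_lie_algebra AG Z)
    (expZ : 'I_d -> R -> G)
    (expZ_exp : forall i, exponential_curve AG (Z i) (expZ i))
    (V := fun i : 'I_d => fundamental_field act (expZ i))
    (Gamma := carre_du_champ V)
    (* the diffusion, its semigroup and its heat kernel *)
    (dO : measure_display) (Omega : measurableType dO)
    (Pr : probability Omega R) (F : R -> set (set Omega))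
    (F_filtration : filtration F)
    (B : 'I_d -> R -> Omega -> R) (B_brownian : brownian_motion Pr F B)
    (X : M -> R -> Omega -> M)
    (X_sde : forall x, sde_solution Pr F AM V B x (X x))
    (P := semigroup Pr X)
    (p : R -> M -> R) (p_kernel : heat_kernel Pr AM mu (X o) p)
    (* the potentials *)
    (Veps : R -> M -> R) (D a : R -> R)
    (Veps_smooth : forall e, 0 < e -> e <= 1 -> smooth_fun AM (Veps e))
    (D_gt0 : forall e, 0 < e -> e <= 1 -> 0 < D e)
    (Veps_bound : forall e, 0 < e -> e <= 1 ->
       forall x, `|Veps e x + ln (p e x)| <= D e)
    (a_gt0 : forall e, 0 < e -> e <= 1 -> 0 < a e)
    (poincare : forall e, 0 < e -> e <= 1 ->
       forall f : M -> R, test_function AM f -> P e f o = 0%E ->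
         ((a e)%:E * P e (fun x => f x ^+ 2)%R o <= P e (Gamma f f) o)%E) :
  forall e, 0 < e -> e <= 1 ->
    let C := expR (2 * D e) / a e in
    [/\ mu.-integrable setT (fun x : borel M => (expR (- Veps e x))%:E),
        0 < C,
        (forall f : M -> R, test_function AM f ->
           (\int[mu]_x (f x * expR (- Veps e x))%:E = 0)%E ->
           (\int[mu]_x (f x ^+ 2 * expR (- Veps e x))%:E <=
            C%:E * \int[mu]_x (Gamma f f x * expR (- Veps e x))%:E)%E) &
        spectral_gap AM mu V (Veps e) (C^-1 / 2)].
Proof.
move=> e e0 e1 C.
have [sq q0 qP] := p_kernel e e0; pose q := p e.
pose w x := expR (- Veps e x).
have q0' x : 0 <= q x by apply: ltW; exact: q0.
have w0 x : 0 <= w x by exact: expR_ge0.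
have qK x : expR (ln (q x)) = q x by rewrite lnK // posrE; exact: q0.
have wq x : w x <= expR (D e) * q x.
  rewrite -qK -expRD ler_expR; have := Veps_bound e e0 e1 x.
  by rewrite ler_norml => /andP[+ _]; rewrite /q; lra.
have qw x : q x <= expR (D e) * w x.
  rewrite -[leLHS]qK -expRD ler_expR; have := Veps_bound e e0 e1 x.
  by rewrite ler_norml => /andP[_]; rewrite /q; lra.
have mq : measurable_fun setT (q : borel M -> R).
  by apply: continuous_borel_measurable; exact: smooth_fun_continuous sq.
have mw : measurable_fun setT (w : borel M -> R).
  apply: measurableT_comp => //; apply: measurableT_comp => //.
  by apply: continuous_borel_measurable; apply: smooth_fun_continuous (Veps_smooth e e0 e1).
have [Xad _ _ _ _] := X_sde o; have [_ Fm _] := F_filtration.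
have mX : measurable_fun setT (X o e : Omega -> borel M).
  move=> _ S mS; rewrite setTI; apply: (Fm e (ltW e0)).
  exact: Xad (ltW e0) S mS.
pose Xmix := isMeasurableFun.Build _ _ _ _ (X o e : Omega -> borel M) mX.
pose Xe : {mfun Omega >-> borel M} := HB.pack (X o e : Omega -> borel M) Xmix.
(* The law of [X o e] has density [p e], so expectations at time [e] are integrals against that
   weight. This links the hypothesis, stated through [P e], with the weights on [M]. *)
have law (h : M -> R) : measurable_fun setT (h : borel M -> R) -> (forall x, 0 <= h x) ->
    (\int[Pr]_x (h (X o e x))%:E = \int[mu]_x (h x * q x)%:E)%E.
  move=> mh h0.
  rewrite -(integral_density (nu := pushforward Pr Xe) mq q0' _ mh h0); last first.
    by move=> S mS; exact: qP.
  rewrite ge0_integral_pushforward //; first by exact/measurable_EFinP.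
  by move=> x _; rewrite lee_fin.
have q1 : (\int[mu]_x (q x)%:E = 1)%E by rewrite -qP // probability_setT.
have iq : mu.-integrable setT (EFin \o (q : borel M -> R)).
  apply/integrableP; split; first exact/measurable_EFinP.
  suff -> : (\int[mu]_x `|(q x)%:E| = 1)%E by rewrite ltry.
  by rewrite -q1; apply: eq_integral => x _ /=; rewrite ger0_norm.
have iw : mu.-integrable setT (EFin \o (w : borel M -> R)).
  have iDq : mu.-integrable setT (fun x => (expR (D e))%:E * (q x)%:E)%E by exact: integrableZl.
  apply: le_integrable iDq => //; first exact/measurable_EFinP.
  by move=> x _; rewrite /= lee_fin !ger0_norm // mulr_ge0 // expR_ge0.
have a0 := a_gt0 e e0 e1.
have C0 : 0 < C by rewrite /C divr_gt0 // expR_gt0.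
have smV f i : test_function AM f -> measurable_fun setT (V i f : borel M -> R).
  by move=> [sf _]; exact: (measurable_fundamental_field G_lie M_manifold act_smooth (expZ_exp i)).
have mtest f : test_function AM f -> measurable_fun setT (f : borel M -> R).
  by move=> [sf _]; apply: continuous_borel_measurable; exact: smooth_fun_continuous sf.
have mGamma f : test_function AM f -> measurable_fun setT (Gamma f f : borel M -> R).
  by move=> tf; apply: measurable_sum => i; apply: measurable_funM; exact: smV.
have Gamma_ge0 f x : 0 <= Gamma f f x.
  by apply: sumr_ge0 => i _; rewrite -expr2 sqr_ge0.
have [Cc [Cc0 [chi [tchi chi01 _ dchi chi1]]]] :=
  bounded_cutoffs G_lie M_manifold act_smooth expZ_exp.
have main f : test_function AM f -> (\int[mu]_x (f x * w x)%:E = 0)%E ->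
    (\int[mu]_x (f x ^+ 2 * w x)%:E <= C%:E * \int[mu]_x (Gamma f f x * w x)%:E)%E.
  move=> tf fw0.
  have [K fK] := test_function_bounded M_manifold tf.
  pose A := fine (\int[Pr]_y (f (X o e y))%:E).
  apply: (@poincare_perturbation _ _ _ mu q w f (Gamma f f) (D e) (a e) A K) => //.
  - exact: mtest.
  - exact: mGamma.
  have mXf (h : M -> R) : measurable_fun setT (h : borel M -> R) ->
    measurable_fun setT (fun y => h (X o e y)) by move=> mh; exact: measurableT_comp mh mX.
  (* The inequality for the weight [p e] is moved to [Omega], where [Pr] is a probability and
     [poincare_mean] applies to compositions with [X o e]. *)
  rewrite -law; [|by apply: measurable_funX; apply: measurable_funB => //; exact: mtest
    |by move=> x; exact: sqr_ge0].
  rewrite -law; [|exact: mGamma|exact: Gamma_ge0].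
  have := @poincare_mean _ _ _ Pr 'I_d (fun y => f (X o e y)) K Cc (a e)
    (fun k y => chi k (X o e y)) (fun i y => V i f (X o e y))
    (fun k i y => V i (chi k) (X o e y)).
  have -> : (\int[Pr]_y (Gamma f f (X o e y))%:E =
      \int[Pr]_y (\sum_(i < d) V i f (X o e y) ^+ 2)%:E)%E.
    by apply: eq_integral.
  apply => //.
  - by apply: mXf; exact: mtest.
  - by move=> k; apply: mXf; exact: mtest.
  - by move=> i; apply: mXf; exact: smV.
  - by move=> k i; apply: mXf; exact: smV.
  - by move=> k i x; exact: dchi.
  move=> k; set al := fine _; cbv zeta; rewrite -/A.
  (* A genuine test function of mean [al * A - A * al = 0] for the law of [X o e], to which the
     assumed inequality applies. *)
  pose g x := al * f x + (- A) * chi k x.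
  have tg : test_function AM g.
    by apply: (test_functionD M_manifold); exact: (test_functionZ M_manifold).
  have iXf : Pr.-integrable setT (EFin \o (fun y => f (X o e y))).
    by apply: (@bounded_integrable _ _ _ Pr _ K) => //; apply: mXf; exact: mtest.
  have iXchi : Pr.-integrable setT (EFin \o (fun y => chi k (X o e y))).
    apply: (@bounded_integrable _ _ _ Pr _ 1); first by apply: mXf; exact: mtest.
    by move=> y; have /andP[c0 c1] := chi01 k (X o e y); rewrite ger0_norm.
  have Pg : P e g o = 0%E.
    rewrite /P /semigroup unlock.
    have -> : (\int[Pr]_y (g (X o e y))%:E = \int[Pr]_y (al%:E * (f (X o e y))%:E +
        (- A)%:E * (chi k (X o e y))%:E))%E by [].
    rewrite integralD //; [|exact: integrableZl|exact: integrableZl].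
    rewrite !integralZl //.
    rewrite -[X in (_ * X + _)%E]fineK; last exact: integrable_fin_num iXf.
    rewrite -[X in (_ + _ * X)%E]fineK; last exact: integrable_fin_num iXchi.
    by rewrite -!EFinM -EFinD -/A -/al; congr EFin; ring.
  have := poincare e e0 e1 g tg Pg; rewrite /P /semigroup unlock.
  have -> : (\int[Pr]_y (Gamma g g (X o e y))%:E =
      \int[Pr]_y (\sum_i (al * V i f (X o e y) - A * V i (chi k) (X o e y)) ^+ 2)%:E)%E.
    apply: eq_integral => y _; rewrite /Gamma /carre_du_champ; congr EFin; apply: eq_bigr => i _.
    have [sf _] := tf; have [sc _] := tchi k.
    rewrite /V (fundamental_field_lin G_lie M_manifold act_smooth (expZ_exp i)) //.
    by rewrite mulNr expr2.
  have -> : (\int[Pr]_y (g (X o e y) ^+ 2)%:E =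
      \int[Pr]_y ((al * f (X o e y) - A * chi k (X o e y)) ^+ 2)%:E)%E.
    by apply: eq_integral => y _; rewrite /g mulNr.
  exact.
split => //; split => //.
- exact: Veps_smooth.
- by rewrite divr_gt0 // invr_gt0.
- move=> f tf fw0; have := main f tf fw0.
  (* The halved size cancels the factor 2 in [spectral_gap], leaving the Poincare inequality with
     constant [C]. *)
  have -> : 2 * (C^-1 / 2) = C^-1 by field; rewrite gt_eqF.
  by rewrite lee_pdivrMl.
Qed.
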